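(* A formal series $\tilde\varphi\in\mathbb{C}[[z^{-1}]]$ is resurgent if and only if there exists a discrete filtered set $\Omega$ such that $\tilde\varphi$ is $\Omega$-resurgent. In other words, $$\hat{\mathscr{R}}=\bigcup_{\Omega\ \text{d.f.s.}}\hat{\mathscr{R}}_\Omega,\qquad \tilde{\mathscr{R}}=\bigcup_{\Omega\ \text{d.f.s.}}\tilde{\mathscr{R}}_\Omega .$$
   Context: A convergent power series $\hat\varphi\in\mathbb{C}\{\zeta\}$ is endlessly continuable if for every $L>0$ there is a finite $F_L\subset\mathbb{C}$ such that $\hat\varphi$ can be analytically continued along every Lipschitz path $\gamma:[0,1]\to\mathbb{C}$ of length $<L$ with $\gamma(0)=0$ and $\gamma((0,1])\subset\mathbb{C}\setminus F_L$; $\hat{\mathscr{R}}$ denotes the space of such functions. The formal Borel transform $\mathcal{B}:\mathbb{C}[[z^{-1}]]\to\mathbb{C}\delta\oplus\mathbb{C}[[\zeta]]$ sends $\sum_{j\ge0}\varphi_jz^{-j}$ to $\varphi_0\delta+\sum_{j\ge1}\varphi_j\zeta^{j-1}/(j-1)!$; $\tilde{\mathscr{R}}=\mathcal{B}^{-1}(\mathbb{C}\delta\oplus\hat{\mathscr{R}})$ is the space of resurgent series. A discrete filtered set (d.f.s.) is a family $\Omega=(\Omega_L)_{L\ge0}$ of finite subsets of $\mathbb{C}$ with $\Omega_{L_1}\subseteq\Omega_{L_2}$ for $L_1\le L_2$ and $\Omega_\delta=\emptyset$ for some $\delta>0$. Let $\mathcal{S}_\Omega=\{(\lambda,\omega)\in\mathbb{R}\times\mathbb{C}\mid\lambda\ge0,\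 \omega\in\Omega_\lambda\}$ and $\mathcal{M}_\Omega=(\mathbb{R}\times\mathbb{C})\setminus\overline{\mathcal{S}_\Omega}$. Let $\Pi$ be the set of Lipschitz paths $\gamma:[0,t_*]\to\mathbb{C}$ ($t_*\ge0$) with $\gamma(0)=0$; for $t\in[0,t_*]$, $\gamma_{|t}$ denotes the restriction to $[0,t]$ and $L(\cdot)$ denotes length. A path $\gamma\in\Pi$ is $\Omega$-allowed if $(L(\gamma_{|t}),\gamma(t))\in\mathcal{M}_\Omega$ for all $t$. A germ $\hat\varphi\in\mathbb{C}\{\zeta\}$ is $\Omega$-continuable if it can be analytically continued along every $\Omega$-allowed path; $\hat{\mathscr{R}}_\Omega$ is the set of such germs, and $\tilde{\mathscr{R}}_\Omega=\mathcal{B}^{-1}(\mathbb{C}\delta\oplus\hat{\mathscr{R}}_\Omega)$ is the set of $\Omega$-resurgent series. *)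

(* Defs.v *)
From Stdlib Require Import Reals List Factorial.
From Coquelicot Require Import Coquelicot.
Open Scope R_scope.

Fixpoint var_sum (gamma : R -> C) (p : nat -> R) (n : nat) : R :=
  match n with
  | O => 0
  | S k => var_sum gamma p k + Cmod (Cminus (gamma (p (S k))) (gamma (p k)))
  end.

Definition partition_of (t : R) (p : nat -> R) (n : nat) : Prop :=
  p O = 0 /\ p n = t /\ (forall i, (i < n)%nat -> p i <= p (S i)).

Definition path_length (gamma : R -> C) (t : R) : R :=
  real (Lub_Rbar (fun l => exists p n, partition_of t p n /\ l = var_sum gamma p n)).

Definition lipschitz_on (gamma : R -> C) (T : R) : Prop :=
  exists K : R, forall s t, 0 <= s <= T -> 0 <= t <= T ->
    Cmod (Cminus (gamma s) (gamma t)) <= K * Rabs (s - t).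

Definition in_Pi (gamma : R -> C) (T : R) : Prop :=
  0 <= T /\ lipschitz_on gamma T /\ gamma 0 = RtoC 0.

(* a convergent power series sum a_n zeta^n: positive radius of convergence *)
Definition convergent (a : nat -> C) : Prop :=
  exists r : R, 0 < r /\ exists M : R, forall n, Cmod (a n) * r ^ n <= M.

Definition holo_on_disc (f : C -> C) (c : C) (r : R) : Prop :=
  forall z, Cmod (Cminus z c) < r -> @ex_derive C_AbsRing C_NormedModule f z.

Definition continuable_along (a : nat -> C) (gamma : R -> C) (T : R) : Prop :=
  exists (f : R -> C -> C) (r : R -> R),
    (forall t, 0 <= t <= T -> 0 < r t /\ holo_on_disc (f t) (gamma t) (r t)) /\
    (exists eps, 0 < eps /\ forall z, Cmod z < eps ->
        @is_series C_AbsRing C_NormedModule (fun n => Cmult (a n) (Cpow z n)) (f 0 z)) /\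
    (forall t, 0 <= t <= T -> exists delta, 0 < delta /\
       forall s, 0 <= s <= T -> Rabs (s - t) < delta ->
         Cmod (Cminus (gamma s) (gamma t)) < r t /\
         exists eps, 0 < eps /\ forall z, Cmod (Cminus z (gamma s)) < eps -> f s z = f t z).

Definition endlessly_continuable (a : nat -> C) : Prop :=
  forall L : R, 0 < L -> exists F : list C,
    forall gamma : R -> C,
      in_Pi gamma 1 -> path_length gamma 1 < L ->
      (forall t, 0 < t <= 1 -> ~ In (gamma t) F) ->
      continuable_along a gamma 1.

Definition hatR (a : nat -> C) : Prop := convergent a /\ endlessly_continuable a.

Definition finite_set (A : C -> Prop) : Prop :=
  exists l : list C, forall w, A w <-> In w l.

Definition dfs (Omega : R -> C -> Prop) : Prop :=
  (forall L, 0 <= L -> finite_set (Omega L)) /\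
  (forall L1 L2 w, 0 <= L1 -> L1 <= L2 -> Omega L1 w -> Omega L2 w) /\
  (exists delta, 0 < delta /\ forall w, ~ Omega delta w).

Definition S_Omega (Omega : R -> C -> Prop) (lam : R) (w : C) : Prop :=
  0 <= lam /\ Omega lam w.

Definition in_closure_S (Omega : R -> C -> Prop) (lam : R) (w : C) : Prop :=
  forall eps, 0 < eps -> exists lam' w', S_Omega Omega lam' w' /\
    Rabs (lam - lam') < eps /\ Cmod (Cminus w w') < eps.

Definition M_Omega (Omega : R -> C -> Prop) (lam : R) (w : C) : Prop :=
  ~ in_closure_S Omega lam w.

Definition Omega_allowed (Omega : R -> C -> Prop) (gamma : R -> C) (T : R) : Prop :=
  in_Pi gamma T /\
  forall t, 0 <= t <= T -> M_Omega Omega (path_length gamma t) (gamma t).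

Definition Omega_continuable (Omega : R -> C -> Prop) (a : nat -> C) : Prop :=
  forall (gamma : R -> C) (T : R), Omega_allowed Omega gamma T -> continuable_along a gamma T.

Definition hatR_Omega (Omega : R -> C -> Prop) (a : nat -> C) : Prop :=
  convergent a /\ Omega_continuable Omega a.

(* A formal series sum_{j>=0} phi j z^{-j} is given by phi : nat -> C.
   Its formal Borel transform is phi 0 delta + sum_{j>=1} phi j zeta^{j-1}/(j-1)!;
   [borel_part phi] is the coefficient sequence of the C[[zeta]] component. *)
Definition borel_part (phi : nat -> C) : nat -> C :=
  fun k => Cdiv (phi (S k)) (RtoC (INR (fact k))).

(* tilde R = B^{-1}(C delta + hat R) *)
Definition resurgent (phi : nat -> C) : Prop := hatR (borel_part phi).

Definition Omega_resurgent (Omega : R -> C -> Prop) (phi : nat -> C) : Prop :=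
  hatR_Omega Omega (borel_part phi).

(* Main.v *)
Require Import Defs.
From Stdlib Require Import Reals List Lra Lia RelationClasses.
From Stdlib Require Import Classical ClassicalDescription IndefiniteDescription.
From Coquelicot Require Import Coquelicot.
Open Scope R_scope.

(** If [Omega] is a discrete filtered set, then [F_L := Omega_L] works, because a closure
    point [(lam, w)] of [S_Omega] with [lam < L] has [w] in [Omega_L].

    Conversely, let [Omega_lam] consist of the end points [w] of the paths of length at most
    [lam] along which the germ can be continued up to, but not including, [w].  By
    construction nothing obstructs continuation along an [Omega]-allowed path.  The point is
    that [Omega_lam] is finite: it is contained in [F_L] for every [L > lam].  Indeed, if [w]
    is not in [F_L], the path to [w], stopped shortly before [w], can be replaced by a slightly
    longer polygon avoiding [F_L] with the same terminal germ, and following the original path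
    from there to [w] shows that [w] is not singular.

    The comparison of germs rests on the identity theorem for functions that are merely complex
    differentiable.  By Goursat's theorem such an [f] has a second primitive [G]; if [f]
    vanishes near [q] then so does [G], and the maximum principle for [G / (z - q)^n], proved
    with the second derivative test, gives [G = 0] on letting [n] grow. *)

Local Notation is_C_derive := (@is_derive C_AbsRing C_NormedModule).
Local Notation ex_C_derive := (@ex_derive C_AbsRing C_NormedModule).
Local Notation is_derive_RC := (@is_derive R_AbsRing C_R_NormedModule).
Local Notation C_RInt := (@RInt C_R_CompleteNormedModule).
Local Notation ex_C_RInt := (@ex_RInt C_R_NormedModule).

Lemma Cmod_minus_sym (a b : C) : Cmod (a - b) = Cmod (b - a).
Proof. now rewrite <- Cmod_opp, Copp_minus_distr. Qed.

Lemma Cmod_minus_triangle (b a c : C) : Cmod (a - c) <= Cmod (a - b) + Cmod (b - c).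
Proof. replace (a - c)%C with ((a - b) + (b - c))%C by ring. apply Cmod_triangle. Qed.

Lemma Cmod_minus_diag (a : C) : Cmod (a - a) = 0.
Proof. replace (a - a)%C with (RtoC 0) by ring. apply Cmod_0. Qed.

Lemma locally_Cmod {p : C} {P : C -> Prop} :
  locally p P <-> exists e, 0 < e /\ forall z, Cmod (z - p) < e -> P z.
Proof.
  rewrite locally_C. split.
  - intros [e He]. exists e. split; [apply cond_pos | exact He].
  - intros [e [He H]]. now exists (mkposreal e He).
Qed.

Lemma locally_Cmod_lt (p : C) e : 0 < e -> locally p (fun z => Cmod (z - p) < e).
Proof. intros He. apply locally_Cmod. now exists e. Qed.

Lemma locally_Cdisc {c p : C} {r} : Cmod (p - c) < r -> locally p (fun z => Cmod (z - c) < r).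
Proof.
  intros Hp. apply locally_Cmod. exists (r - Cmod (p - c)). split; [lra|].
  intros z Hz. assert (T := Cmod_minus_triangle p z c). lra.
Qed.

Lemma locally_R {x : R} {P : R -> Prop} :
  locally x P <-> exists d, 0 < d /\ forall y, x - d < y < x + d -> P y.
Proof.
  split.
  - intros [d Hd]. exists d. split; [apply cond_pos|]. intros y Hy.
    apply Hd, Rabs_def1; unfold minus, plus, opp; simpl; lra.
  - intros [d [Hd H]]. exists (mkposreal d Hd). intros y Hy.
    apply Rabs_def2 in Hy. unfold minus, plus, opp in Hy. simpl in Hy. apply H. lra.
Qed.

(** * Complex derivatives and integrals over chords *)

Lemma is_C_derive_iff {f : C -> C} {z l : C} :
  is_C_derive f z l <-> forall e, 0 < e ->
    locally z (fun w => Cmod (f w - f z - l * (w - z)) <= e * Cmod (w - z)).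
Proof.
  split.
  - intros [_ H] e He. apply locally_C.
    assert (D := H z (fun P HP => HP) (mkposreal e He)). revert D.
    apply filter_imp. intros w Hw.
    replace (l * (w - z))%C with ((w - z) * l)%C by ring. exact Hw.
  - intros H. split; [apply (is_linear_scal_l (V := C_NormedModule))|]. intros z' Hz' e.
    rewrite <- (is_filter_lim_locally_unique _ _ Hz').
    assert (D := proj1 (locally_C _ _) (H e (cond_pos e))). revert D.
    apply filter_imp. intros w Hw.
    replace (l * (w - z))%C with ((w - z) * l)%C in Hw by ring. exact Hw.
Qed.

Lemma ex_C_derive_continuous (f : C -> C) (z : C) : ex_C_derive f z -> continuous f z.
Proof. intros Hf P HP. apply locally_C. now apply (ex_derive_continuous f z Hf). Qed.

Lemma is_C_derive_ext_loc (f g : C -> C) (z l : C) : locally z (fun w => f w = g w) ->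
  is_C_derive f z l -> is_C_derive g z l.
Proof. intros H. apply is_derive_ext_loc. now apply locally_C. Qed.

(* The two normed modules differ in their uniform structure only: balls are squares in
   [C_NormedModule] and discs in [AbsRing_NormedModule C_AbsRing]. *)
Lemma is_C_derive_AbsRing (f : C -> C) (z l : C) :
  is_C_derive f z l <-> @is_derive C_AbsRing (AbsRing_NormedModule C_AbsRing) f z l.
Proof.
  split; intros [_ H]; split; auto.
  - apply is_linear_scal_l.
  - apply (is_linear_scal_l (V := C_NormedModule)).
Qed.

Lemma is_C_derive_mult (f g : C -> C) (z l m : C) : is_C_derive f z l -> is_C_derive g z m ->
  is_C_derive (fun w => f w * g w)%C z (l * g z + f z * m)%C.
Proof.
  rewrite !is_C_derive_AbsRing. intros Hf Hg.
  exact (@is_derive_mult C_AbsRing f g z l m Hf Hg Cmult_comm).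
Qed.

Lemma is_C_derive_comp (f g : C -> C) (z l m : C) : is_C_derive f (g z) l -> is_C_derive g z m ->
  is_C_derive (fun w => f (g w)) z (m * l)%C.
Proof.
  rewrite (is_C_derive_AbsRing g). exact (@is_derive_comp C_AbsRing C_NormedModule f g z l m).
Qed.

Lemma is_C_derive_plus (f g : C -> C) (z l m : C) : is_C_derive f z l -> is_C_derive g z m ->
  is_C_derive (fun w => f w + g w)%C z (l + m)%C.
Proof. exact (@is_derive_plus C_AbsRing C_NormedModule f g z l m). Qed.

Lemma is_C_derive_minus (f g : C -> C) (z l m : C) : is_C_derive f z l -> is_C_derive g z m ->
  is_C_derive (fun w => f w - g w)%C z (l - m)%C.
Proof. exact (@is_derive_minus C_AbsRing C_NormedModule f g z l m). Qed.

Lemma is_C_derive_const (c z : C) : is_C_derive (fun _ => c) z (RtoC 0).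
Proof. exact (@is_derive_const C_AbsRing C_NormedModule c z). Qed.

Lemma is_C_derive_id (z : C) : is_C_derive (fun w => w) z (RtoC 1).
Proof. apply is_C_derive_AbsRing, (@is_derive_id C_AbsRing). Qed.

Lemma is_C_derive_inv (z : C) : z <> 0 -> is_C_derive (fun w => / w)%C z (- (/ z * / z))%C.
Proof.
  intros Hz. apply is_C_derive_iff. intros e He.
  assert (Hm : 0 < Cmod z) by now apply Cmod_gt_0. set (m := Cmod z) in *.
  assert (Hm3 : 0 < m ^ 3) by now apply pow_lt.
  apply (filter_imp (fun w => Cmod (w - z) < m / 2 /\ Cmod (w - z) < e * m ^ 3 / 2)).
  2:{ apply filter_and; apply locally_Cmod_lt; nra. }
  intros w [Hw1 Hw2].
  assert (Hwm : m / 2 <= Cmod w).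
  { assert (T := Cmod_triangle w (z - w)). replace (w + (z - w))%C with z in T by ring.
    rewrite (Cmod_minus_sym z) in T. fold m in T. lra. }
  assert (Hw0 : w <> 0) by (apply Cmod_gt_0; lra).
  replace (/ w - / z - - (/ z * / z) * (w - z))%C with
    ((w - z) * ((w - z) * (/ z * / z * / w)))%C by (field; auto).
  rewrite !Cmod_mult, !Cmod_inv by auto. fold m.
  rewrite (Rmult_comm e). apply Rmult_le_compat_l; [apply Cmod_ge_0|].
  assert (Hinv : / Cmod w <= 2 / m).
  { replace (2 / m) with (/ (m / 2)) by (field; lra). apply Rinv_le_contravar; lra. }
  assert (Him : 0 < / m) by now apply Rinv_0_lt_compat.
  apply Rle_trans with (e * m ^ 3 / 2 * (/ m * / m * (2 / m))).
  - apply Rmult_le_compat; [apply Cmod_ge_0 | | lra |].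
    + apply Rmult_le_pos; [nra|]. left. apply Rinv_0_lt_compat. lra.
    + apply Rmult_le_compat_l; nra.
  - right. field. lra.
Qed.

Lemma is_C_derive_minus_const (q z : C) : is_C_derive (fun w => w - q)%C z (RtoC 1).
Proof.
  replace (RtoC 1) with (1 - 0)%C by ring.
  exact (is_C_derive_minus _ _ _ _ _ (is_C_derive_id z) (is_C_derive_const q z)).
Qed.

Lemma is_C_derive_affine (u v z : C) : is_C_derive (fun w => u + v * w)%C z v.
Proof.
  apply is_C_derive_iff. intros e He. apply filter_forall. intros w.
  replace (u + v * w - (u + v * z) - v * (w - z))%C with (RtoC 0) by ring. rewrite Cmod_0.
  apply Rmult_le_pos; [lra | apply Cmod_ge_0].
Qed.

Definition chord (a b : C) (t : R) : C := (a + t * (b - a))%C.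

Lemma chord_0 (a b : C) : chord a b 0 = a.
Proof. unfold chord. ring. Qed.

Lemma chord_1 (a b : C) : chord a b 1 = b.
Proof. unfold chord. ring. Qed.

Lemma Cmod_chord_minus (a b : C) s t :
  Cmod (chord a b s - chord a b t) = Cmod (b - a) * Rabs (s - t).
Proof.
  unfold chord. replace (a + s * (b - a) - (a + t * (b - a)))%C with ((b - a) * (s - t)%R)%C
    by (rewrite RtoC_minus; ring).
  now rewrite Cmod_mult, Cmod_R.
Qed.

Lemma chord_in_disc (q a b : C) r t : Cmod (a - q) < r -> Cmod (b - q) < r -> 0 <= t <= 1 ->
  Cmod (chord a b t - q) < r.
Proof.
  intros Ha Hb Ht. unfold chord.
  replace (a + t * (b - a) - q)%C with ((1 - t)%R * (a - q) + t * (b - q))%C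
    by (rewrite RtoC_minus; ring).
  eapply Rle_lt_trans; [apply Cmod_triangle|].
  rewrite !Cmod_mult, !Cmod_R, !Rabs_pos_eq by lra.
  destruct (Req_dec t 0) as [->|Ht0]; [lra|].
  assert (0 < t * (r - Cmod (b - q))) by (apply Rmult_lt_0_compat; lra).
  assert (0 <= (1 - t) * (r - Cmod (a - q))) by (apply Rmult_le_pos; lra). lra.
Qed.

Lemma is_C_derive_chord (f : C -> C) (a b l : C) t : is_C_derive f (chord a b t) l ->
  is_derive_RC (fun s => f (chord a b s)) t (l * (b - a))%C.
Proof.
  intros Hf. split; [apply (is_linear_scal_l (V := C_R_NormedModule))|]. intros t' Ht' e.
  rewrite <- (is_filter_lim_locally_unique _ _ Ht').
  set (M := Cmod (b - a)). assert (HM : 0 <= M) by apply Cmod_ge_0.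
  assert (He : 0 < e / (M + 1)) by (apply Rdiv_lt_0_compat; [apply cond_pos | lra]).
  destruct (proj1 locally_Cmod (proj1 is_C_derive_iff Hf _ He)) as [d [Hd H]].
  assert (Hd' : 0 < d / (M + 1)) by (apply Rdiv_lt_0_compat; lra).
  exists (mkposreal _ Hd'). intros s Hs.
  change (Rabs (s - t) < d / (M + 1)) in Hs.
  assert (Hst := Rabs_pos (s - t)).
  assert (Hs' : (M + 1) * Rabs (s - t) < d).
  { replace d with ((M + 1) * (d / (M + 1))) by (field; lra). apply Rmult_lt_compat_l; lra. }
  assert (Hc : Cmod (chord a b s - chord a b t) = M * Rabs (s - t)) by apply Cmod_chord_minus.
  specialize (H (chord a b s)). rewrite Hc in H. specialize (H ltac:(nra)).
  rewrite <- Cmod_norm.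
  change (Cmod (f (chord a b s) - f (chord a b t)
    - @scal R_AbsRing C_R_NormedModule (s - t)%R (l * (b - a))%C) <= e * Rabs (s - t)).
  rewrite scal_R_Cmult.
  replace (RtoC (s - t) * (l * (b - a)))%C with (l * (chord a b s - chord a b t))%C
    by (unfold chord; rewrite RtoC_minus; ring).
  eapply Rle_trans; [exact H|]. rewrite <- Rmult_assoc. apply Rmult_le_compat_r; auto.
  replace (pos e) with (e / (M + 1) * (M + 1)) at 2 by (field; lra).
  apply Rmult_le_compat_l; lra.
Qed.

Lemma continuous_chord (f : C -> C) (a b : C) t : continuous f (chord a b t) ->
  continuous (fun s => f (chord a b s)) t.
Proof.
  apply continuous_comp. apply (@ex_derive_continuous R_AbsRing C_R_NormedModule).
  eexists. apply (is_C_derive_chord (fun z => z)), is_C_derive_id.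
Qed.

Definition seg_int (f : C -> C) (a b : C) : C :=
  C_RInt (fun t => f (chord a b t) * (b - a))%C 0 1.

Definition continuous_on_chord (f : C -> C) (a b : C) : Prop :=
  forall t, 0 <= t <= 1 -> continuous f (chord a b t).

Lemma continuous_Cmult_r (c z : C) : continuous (fun w => w * c)%C z.
Proof.
  apply ex_C_derive_continuous. eexists.
  apply (is_C_derive_mult _ (fun _ => c) _ _ _ (is_C_derive_id z) (is_C_derive_const c z)).
Qed.

Lemma continuous_seg_integrand (f : C -> C) (a b : C) t : continuous f (chord a b t) ->
  continuous (fun s => f (chord a b s) * (b - a))%C t.
Proof.
  intros Hf. apply (continuous_comp (fun s => f (chord a b s)) (fun z => z * (b - a))%C).
  - now apply continuous_chord.
  - apply continuous_Cmult_r.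
Qed.

Lemma ex_seg_int (f : C -> C) (a b : C) : continuous_on_chord f a b ->
  ex_C_RInt (fun t => f (chord a b t) * (b - a))%C 0 1.
Proof.
  intros Hf. apply (ex_RInt_continuous (V := C_R_CompleteNormedModule)).
  rewrite Rmin_left, Rmax_right by lra. intros t Ht.
  now apply continuous_seg_integrand, Hf.
Qed.

Lemma Cmod_seg_int_le (f : C -> C) (a b : C) M : continuous_on_chord f a b ->
  (forall t, 0 <= t <= 1 -> Cmod (f (chord a b t)) <= M) ->
  Cmod (seg_int f a b) <= M * Cmod (b - a).
Proof.
  intros Hf HM. rewrite Cmod_norm.
  replace (M * Cmod (b - a)) with (Rabs (1 - 0) * (M * Cmod (b - a)))
    by (rewrite Rabs_pos_eq by lra; ring).
  refine (norm_RInt_le_const_abs (V := C_R_NormedModule) _ _ _ _ _ _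
    (RInt_correct (V := C_R_CompleteNormedModule) _ _ _ (ex_seg_int f a b Hf))).
  rewrite Rmin_left, Rmax_right by lra. intros t Ht.
  rewrite <- Cmod_norm, Cmod_mult. apply Rmult_le_compat_r; [apply Cmod_ge_0 | auto].
Qed.

Lemma seg_int_minus (f g : C -> C) (a b : C) :
  continuous_on_chord f a b -> continuous_on_chord g a b ->
  seg_int (fun z => f z - g z)%C a b = (seg_int f a b - seg_int g a b)%C.
Proof.
  intros Hf Hg. unfold seg_int.
  rewrite <- (RInt_minus (V := C_R_CompleteNormedModule)) by now apply ex_seg_int.
  apply (RInt_ext (V := C_R_CompleteNormedModule)). intros t _.
  change ((f (chord a b t) - g (chord a b t)) * (b - a) =
    f (chord a b t) * (b - a) - g (chord a b t) * (b - a))%C. ring.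
Qed.

Lemma seg_int_derive (F f : C -> C) (a b : C) : continuous_on_chord f a b ->
  (forall t, 0 <= t <= 1 -> is_C_derive F (chord a b t) (f (chord a b t))) ->
  seg_int f a b = (F b - F a)%C.
Proof.
  intros Hf HF.
  transitivity (F (chord a b 1) - F (chord a b 0))%C; [|now rewrite chord_0, chord_1].
  apply (is_RInt_unique (V := C_R_CompleteNormedModule)).
  refine (is_RInt_derive (V := C_R_CompleteNormedModule) (fun t => F (chord a b t))
    (fun t => f (chord a b t) * (b - a))%C 0 1 _ _);
    rewrite Rmin_left, Rmax_right by lra; intros t Ht.
  - now apply is_C_derive_chord, HF.
  - now apply continuous_seg_integrand, Hf.
Qed.

Lemma seg_int_affine (u v a b : C) :
  seg_int (fun z => u + v * z)%C a b =
    (u * b + v * b ^ 2 / 2 - (u * a + v * a ^ 2 / 2))%C.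
Proof.
  apply (seg_int_derive (fun z => u * z + v * z ^ 2 / 2)%C); intros t _.
  - apply ex_C_derive_continuous. eexists. apply is_C_derive_affine.
  - apply (is_C_derive_ext_loc (fun z => (u + v / 2 * z) * z)%C).
    + apply filter_forall. intros z. field.
    + replace (u + v * chord a b t)%C with
        (v / 2 * chord a b t + (u + v / 2 * chord a b t) * 1)%C by field.
      apply (is_C_derive_mult (fun z => u + v / 2 * z)%C (fun z => z)).
      * apply is_C_derive_affine.
      * apply is_C_derive_id.
Qed.

Lemma chord_chord (a b : C) s t x :
  chord (chord a b s) (chord a b t) x = chord a b (s + x * (t - s)).
Proof. unfold chord. rewrite RtoC_plus, RtoC_mult, RtoC_minus. ring. Qed.

Lemma seg_int_chord (f : C -> C) (a b : C) s t : 0 <= s <= 1 -> 0 <= t <= 1 ->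
  continuous_on_chord f a b ->
  seg_int f (chord a b s) (chord a b t) = C_RInt (fun x => f (chord a b x) * (b - a))%C s t.
Proof.
  intros Hs Ht Hf.
  assert (Hex : ex_C_RInt (fun x => f (chord a b x) * (b - a))%C
    ((t - s) * 0 + s) ((t - s) * 1 + s)).
  { replace ((t - s) * 0 + s) with s by ring. replace ((t - s) * 1 + s) with t by ring.
    apply (ex_RInt_continuous (V := C_R_CompleteNormedModule)). intros x Hx.
    apply continuous_seg_integrand, Hf. revert Hx.
    unfold Rmin, Rmax. destruct (Rle_dec s t); lra. }
  assert (E := RInt_comp_lin (V := C_R_CompleteNormedModule) _ _ _ _ _ Hex).
  replace ((t - s) * 0 + s) with s in E by ring. replace ((t - s) * 1 + s) with t in E by ring.
  rewrite <- E. apply (RInt_ext (V := C_R_CompleteNormedModule)). intros x _.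
  rewrite chord_chord, (Rplus_comm s), (Rmult_comm x).
  change (f (chord a b ((t - s) * x + s)) * (chord a b t - chord a b s) =
    @scal R_AbsRing C_R_NormedModule (t - s)%R (f (chord a b ((t - s) * x + s)) * (b - a)))%C.
  rewrite scal_R_Cmult. unfold chord. rewrite RtoC_minus. ring.
Qed.

Lemma seg_int_split (f : C -> C) (a b : C) t : 0 <= t <= 1 -> continuous_on_chord f a b ->
  seg_int f a b = (seg_int f a (chord a b t) + seg_int f (chord a b t) b)%C.
Proof.
  intros Ht Hf.
  assert (E := fun s t Hs Ht => seg_int_chord f a b s t Hs Ht Hf).
  transitivity (seg_int f (chord a b 0) (chord a b 1)); [now rewrite chord_0, chord_1|].
  transitivity (seg_int f (chord a b 0) (chord a b t) + seg_int f (chord a b t) (chord a b 1))%C;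
    [|now rewrite chord_0, chord_1].
  rewrite !E by lra.
  symmetry. apply (RInt_Chasles (V := C_R_CompleteNormedModule) _ 0 t 1);
    apply (ex_RInt_continuous (V := C_R_CompleteNormedModule)); intros x Hx;
    rewrite Rmin_left, Rmax_right in Hx by lra; apply continuous_seg_integrand, Hf; lra.
Qed.

Lemma Cmod_seg_int_minus_affine (f : C -> C) (u v a b : C) e : continuous_on_chord f a b ->
  (forall t, 0 <= t <= 1 -> Cmod (f (chord a b t) - (u + v * chord a b t)) <= e) ->
  Cmod (seg_int f a b - (u * b + v * b ^ 2 / 2 - (u * a + v * a ^ 2 / 2))) <= e * Cmod (b - a).
Proof.
  intros Hf He.
  assert (Haff : forall z, continuous (fun z => u + v * z)%C z).
  { intros z. apply ex_C_derive_continuous. eexists. apply is_C_derive_affine. }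
  rewrite <- seg_int_affine, <- seg_int_minus by (auto; intros t _; apply Haff).
  apply Cmod_seg_int_le; auto.
  intros t Ht. apply (continuous_minus (V := C_R_NormedModule) f); [now apply Hf | apply Haff].
Qed.

Lemma seg_int_point (f : C -> C) (a : C) : seg_int f a a = 0.
Proof.
  unfold seg_int.
  rewrite (RInt_ext (V := C_R_CompleteNormedModule) _ (fun _ => RtoC 0)).
  - rewrite RInt_const. apply (scal_zero_r (V := C_R_NormedModule)).
  - intros t _. unfold Cminus. rewrite Cplus_opp_r. apply Cmult_0_r.
Qed.

(** * Goursat's theorem and primitives *)

Lemma nested_intervals (x s : nat -> R) : (forall n, x n <= x (S n)) ->
  (forall n, x (S n) + s (S n) <= x n + s n) -> is_lim_seq s 0 ->
  exists u, forall n, x n <= u <= x n + s n.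
Proof.
  intros Hx Hxs Hs.
  destruct (ex_lim_seq_adj x (fun n => x n + s n) Hx Hxs) as [[u Hu] [[v Hv] E]].
  - apply (is_lim_seq_ext s); [intros n; ring | exact Hs].
  - rewrite (is_lim_seq_unique _ _ Hu), (is_lim_seq_unique _ _ Hv) in E.
    injection E as <-. exists u. intros n. split.
    + now apply is_lim_seq_incr_compare.
    + exact (is_lim_seq_decr_compare _ _ Hv Hxs n).
Qed.

(* A triple (x, y, s) stands for the square [x, x + s] * [y, y + s]. *)
Definition quarter (q q' : R * R * R) : Prop :=
  let '(x, y, s) := q in let '(x', y', s') := q' in
  s' = s / 2 /\ x <= x' <= x + s / 2 /\ y <= y' <= y + s / 2.

Lemma nested_quarters (q : nat -> R * R * R) : (forall n, quarter (q n) (q (S n))) ->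
  exists u v, forall d, 0 < d -> exists n, let '(x, y, s) := q n in
    s < d /\ x <= u <= x + s /\ y <= v <= y + s.
Proof.
  intros Hq.
  set (x := fun n => fst (fst (q n))). set (y := fun n => snd (fst (q n))).
  set (s := fun n => snd (q n)).
  assert (Eq : forall n, q n = (x n, y n, s n)).
  { intros n. unfold x, y, s. now destruct (q n) as [[? ?] ?]. }
  assert (Hnext : forall n, s (S n) = s n / 2 /\ x n <= x (S n) <= x n + s n / 2 /\
    y n <= y (S n) <= y n + s n / 2).
  { intros n. specialize (Hq n). now rewrite !Eq in Hq. }
  assert (Hs : forall n, s 0%nat * (/ 2) ^ n = s n).
  { induction n as [|n IH]; [simpl; ring|].
    rewrite (proj1 (Hnext n)), <- IH. simpl. field. }
  assert (Hs_lim : is_lim_seq s 0).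
  { apply (is_lim_seq_ext _ _ _ Hs).
    replace (Finite 0) with (Rbar_mult (s 0%nat) 0) by (simpl; f_equal; ring).
    apply is_lim_seq_scal_l, is_lim_seq_geom. rewrite Rabs_pos_eq; lra. }
  destruct (nested_intervals x s) as [u Hu]; [| |exact Hs_lim|].
  1,2: intros n; specialize (Hnext n); lra.
  destruct (nested_intervals y s) as [v Hv]; [| |exact Hs_lim|].
  1,2: intros n; specialize (Hnext n); lra.
  exists u, v. intros d Hd.
  destruct (proj2 (is_lim_seq_spec _ _) Hs_lim (mkposreal d Hd)) as [n Hn].
  specialize (Hn n (le_n n)). simpl in Hn. apply Rabs_def2 in Hn.
  exists n. rewrite Eq. repeat split; try apply Hu; try apply Hv. lra.
Qed.

Definition subsquare (x0 y0 s0 x y s : R) : Prop :=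
  0 <= s /\ x0 <= x /\ x + s <= x0 + s0 /\ y0 <= y /\ y + s <= y0 + s0.

Lemma square_bisection (P : R -> R -> R -> Prop) x0 y0 s0 : 0 <= s0 ->
  (forall x y s, subsquare x0 y0 s0 x y s ->
    P x y (s / 2) -> P (x + s / 2) y (s / 2) ->
    P x (y + s / 2) (s / 2) -> P (x + s / 2) (y + s / 2) (s / 2) -> P x y s) ->
  (forall u v, x0 <= u <= x0 + s0 -> y0 <= v <= y0 + s0 -> exists d, 0 < d /\
    forall x y s, subsquare x0 y0 s0 x y s -> s < d ->
      x <= u <= x + s -> y <= v <= y + s -> P x y s) ->
  P x0 y0 s0.
Proof.
  intros Hs0 Hsub Hloc. apply NNPP. intros Hbad0.
  pose (bad := fun q : R * R * R => let '(x, y, s) := q in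
    subsquare x0 y0 s0 x y s /\ ~ P x y s).
  assert (Hstep : forall q, exists q', bad q -> bad q' /\ quarter q q').
  { intros [[x y] s]. destruct (classic (bad (x, y, s))) as [[Hq HP]|Hq]; [|now exists (x, y, s)].
    apply NNPP. intros Hno. apply HP.
    assert (Hquarter : forall x' y', x <= x' <= x + s / 2 -> y <= y' <= y + s / 2 ->
      P x' y' (s / 2)).
    { intros x' y' Hx' Hy'. apply NNPP. intros HP'. apply Hno. exists (x', y', s / 2). intros _.
      unfold bad, quarter, subsquare in *. repeat split; auto; lra. }
    unfold subsquare in Hq. apply Hsub; [auto | | | |]; apply Hquarter; lra. }
  destruct (functional_choice _ Hstep) as [next Hnext].
  set (q := fun n => Nat.iter n next (x0, y0, s0)).
  assert (Hbad : forall n, bad (q n)).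
  { induction n as [|n IH]; [|now apply Hnext]. split; [|auto]. unfold subsquare. lra. }
  destruct (nested_quarters q) as [u [v Huv]]; [intros n; now apply Hnext|].
  assert (Hin : x0 <= u <= x0 + s0 /\ y0 <= v <= y0 + s0).
  { destruct (Huv 1 Rlt_0_1) as [n Hn]. specialize (Hbad n).
    destruct (q n) as [[x y] s]. destruct Hbad as [Hsq _]. unfold subsquare in Hsq. lra. }
  destruct (Hloc u v) as [d [Hd HP]]; try apply Hin.
  destruct (Huv d Hd) as [n Hn]. specialize (Hbad n).
  destruct (q n) as [[x y] s]. destruct Hbad as [Hsq Hnot]. now apply Hnot, HP.
Qed.

Definition quad_int (f : C -> C) (p00 p10 p11 p01 : C) : C :=
  (seg_int f p00 p10 + seg_int f p10 p11 - seg_int f p01 p11 - seg_int f p00 p01)%C.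

Definition affine_up_to (f : C -> C) (u v : C) (e r : R) (p q : C) : Prop :=
  continuous_on_chord f p q /\ Cmod (q - p) <= r /\
  forall t, 0 <= t <= 1 -> Cmod (f (chord p q t) - (u + v * chord p q t)) <= e.

Lemma Cmod_quad_int_le (f : C -> C) (u v p00 p10 p11 p01 : C) e r :
  affine_up_to f u v e r p00 p10 -> affine_up_to f u v e r p10 p11 ->
  affine_up_to f u v e r p01 p11 -> affine_up_to f u v e r p00 p01 ->
  Cmod (quad_int f p00 p10 p11 p01) <= 4 * e * r.
Proof.
  set (G := fun z => (u * z + v * z ^ 2 / 2)%C).
  assert (Hedge : forall p q, affine_up_to f u v e r p q ->
    Cmod (seg_int f p q - (G q - G p)) <= e * r).
  { intros p q [Hc [Hr He]]. eapply Rle_trans; [now apply (Cmod_seg_int_minus_affine f u v p q e)|].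
    apply Rmult_le_compat_l; auto.
    eapply Rle_trans; [apply Cmod_ge_0 | apply (He 0); lra]. }
  intros Hbottom Hright Htop Hleft. apply Hedge in Hbottom, Hright, Htop, Hleft. unfold quad_int.
  replace (seg_int f p00 p10 + seg_int f p10 p11 - seg_int f p01 p11 - seg_int f p00 p01)%C with
    ((seg_int f p00 p10 - (G p10 - G p00)) + (seg_int f p10 p11 - (G p11 - G p10))
     + (- (seg_int f p01 p11 - (G p11 - G p01))
        + - (seg_int f p00 p01 - (G p01 - G p00))))%C by ring.
  eapply Rle_trans; [apply Cmod_triangle|].
  eapply Rle_trans; [apply Rplus_le_compat; apply Cmod_triangle|].
  rewrite !Cmod_opp. lra.
Qed.

(* The triangle a b c as an image of the unit square whose side s = 0 is collapsed to a. *)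
Definition triangle (a b c : C) (s t : R) : C := chord a (chord b c t) s.

Lemma chord_triangle_row (a b c : C) s s' t x :
  chord (triangle a b c s t) (triangle a b c s' t) x = triangle a b c (s + x * (s' - s)) t.
Proof. apply chord_chord. Qed.

Lemma chord_triangle_col (a b c : C) s t t' x :
  chord (triangle a b c s t) (triangle a b c s t') x = triangle a b c s (t + x * (t' - t)).
Proof.
  unfold triangle. rewrite <- (chord_chord b c). unfold chord. ring.
Qed.

Definition triangle_cell_int (f : C -> C) (a b c : C) (u v s : R) : C :=
  quad_int f (triangle a b c u v) (triangle a b c (u + s) v)
    (triangle a b c (u + s) (v + s)) (triangle a b c u (v + s)).

Section Goursat.

Variables (f : C -> C) (a b c : C).
Hypothesis f_derivable :
  forall s t, 0 <= s <= 1 -> 0 <= t <= 1 -> ex_C_derive f (triangle a b c s t).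

Let diam : R := Cmod (b - a) + 2 * Cmod (c - b).

Lemma continuous_on_triangle_row s s' t : 0 <= s <= 1 -> 0 <= s' <= 1 -> 0 <= t <= 1 ->
  continuous_on_chord f (triangle a b c s t) (triangle a b c s' t).
Proof.
  intros Hs Hs' Ht x Hx. rewrite chord_triangle_row.
  apply ex_C_derive_continuous, f_derivable; auto. nra.
Qed.

Lemma continuous_on_triangle_col s t t' : 0 <= s <= 1 -> 0 <= t <= 1 -> 0 <= t' <= 1 ->
  continuous_on_chord f (triangle a b c s t) (triangle a b c s t').
Proof.
  intros Hs Ht Ht' x Hx. rewrite chord_triangle_col.
  apply ex_C_derive_continuous, f_derivable; auto. nra.
Qed.

Lemma seg_int_split_row s r t : 0 <= s -> 0 <= r -> s + r <= 1 -> 0 <= t <= 1 ->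
  seg_int f (triangle a b c s t) (triangle a b c (s + r) t) =
    (seg_int f (triangle a b c s t) (triangle a b c (s + r / 2) t)
     + seg_int f (triangle a b c (s + r / 2) t) (triangle a b c (s + r) t))%C.
Proof.
  intros Hs Hr Hsr Ht.
  rewrite (seg_int_split f _ _ (/ 2)) by (try apply continuous_on_triangle_row; lra).
  rewrite chord_triangle_row. now replace (s + / 2 * (s + r - s)) with (s + r / 2) by field.
Qed.

Lemma seg_int_split_col s t r : 0 <= s <= 1 -> 0 <= t -> 0 <= r -> t + r <= 1 ->
  seg_int f (triangle a b c s t) (triangle a b c s (t + r)) =
    (seg_int f (triangle a b c s t) (triangle a b c s (t + r / 2))
     + seg_int f (triangle a b c s (t + r / 2)) (triangle a b c s (t + r)))%C.
Proof.
  intros Hs Ht Hr Htr.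
  rewrite (seg_int_split f _ _ (/ 2)) by (try apply continuous_on_triangle_col; lra).
  rewrite chord_triangle_col. now replace (t + / 2 * (t + r - t)) with (t + r / 2) by field.
Qed.

Lemma triangle_cell_int_split u v s : subsquare 0 0 1 u v s ->
  triangle_cell_int f a b c u v s =
    (triangle_cell_int f a b c u v (s / 2) + triangle_cell_int f a b c (u + s / 2) v (s / 2)
     + (triangle_cell_int f a b c u (v + s / 2) (s / 2)
        + triangle_cell_int f a b c (u + s / 2) (v + s / 2) (s / 2)))%C.
Proof.
  unfold subsquare. intros H. unfold triangle_cell_int, quad_int.
  replace (u + s / 2 + s / 2) with (u + s) by field.
  replace (v + s / 2 + s / 2) with (v + s) by field.
  rewrite (seg_int_split_row u s v), (seg_int_split_row u s (v + s)),
    (seg_int_split_col u v s), (seg_int_split_col (u + s) v s) by lra.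
  ring.
Qed.

Lemma Cmod_triangle_minus_le s t s' t' r : 0 <= s <= 1 -> 0 <= t' <= 1 ->
  Rabs (s' - s) <= r -> Rabs (t' - t) <= r ->
  Cmod (triangle a b c s' t' - triangle a b c s t) <= r * diam.
Proof.
  intros Hs Ht' Hss Htt.
  replace (triangle a b c s' t' - triangle a b c s t)%C with
    ((s' - s)%R * ((b - a) + t' * (c - b)) + s * ((t' - t)%R * (c - b)))%C
    by (unfold triangle, chord; rewrite !RtoC_minus; ring).
  eapply Rle_trans; [apply Cmod_triangle|]. rewrite !Cmod_mult, !Cmod_R, (Rabs_pos_eq s) by lra.
  assert (T := Cmod_triangle (b - a) (t' * (c - b))).
  rewrite Cmod_mult, Cmod_R, Rabs_pos_eq in T by lra.
  assert (Hc := Cmod_ge_0 (c - b)). assert (Hr := Rabs_pos (s' - s)).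
  assert (t' * Cmod (c - b) <= 1 * Cmod (c - b)) by (apply Rmult_le_compat_r; lra).
  assert (Rabs (s' - s) * Cmod (b - a + t' * (c - b)) <= r * (Cmod (b - a) + Cmod (c - b)))
    by (apply Rmult_le_compat; try apply Cmod_ge_0; lra).
  assert (Rabs (t' - t) * Cmod (c - b) <= r * Cmod (c - b)) by (apply Rmult_le_compat_r; lra).
  assert (s * (Rabs (t' - t) * Cmod (c - b)) <= 1 * (r * Cmod (c - b))).
  { apply Rmult_le_compat; try lra. apply Rmult_le_pos; [apply Rabs_pos | lra]. }
  unfold diam. lra.
Qed.

Lemma triangle_cell_int_small e u0 v0 : 0 < e -> 0 <= u0 <= 1 -> 0 <= v0 <= 1 ->
  exists d, 0 < d /\ forall u v s, subsquare 0 0 1 u v s -> s < d ->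
    u <= u0 <= u + s -> v <= v0 <= v + s ->
    Cmod (triangle_cell_int f a b c u v s) <= 4 * e * (s * diam) ^ 2.
Proof.
  intros He Hu0 Hv0. set (z0 := triangle a b c u0 v0).
  destruct (f_derivable u0 v0 Hu0 Hv0) as [l Hl].
  destruct (proj1 locally_Cmod (proj1 is_C_derive_iff Hl e He)) as [d [Hd H]].
  fold z0 in H.
  assert (Hdiam : 0 <= diam).
  { unfold diam. assert (h := Cmod_ge_0 (b - a)). assert (h' := Cmod_ge_0 (c - b)). lra. }
  exists (d / (diam + 1)). split; [apply Rdiv_lt_0_compat; lra|].
  unfold subsquare. intros u v s Hsq Hsd Hu Hv.
  assert (Hs : s * diam < d).
  { apply (Rmult_lt_compat_r (diam + 1)) in Hsd; [|lra].
    replace (d / (diam + 1) * (diam + 1)) with d in Hsd by (field; lra). lra. }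
  assert (Hsdiam : 0 <= s * diam) by (apply Rmult_le_pos; lra).
  assert (Hnear : forall u' v', u <= u' <= u + s -> v <= v' <= v + s ->
    Cmod (f (triangle a b c u' v') - (f z0 - l * z0 + l * triangle a b c u' v')) <= e * (s * diam)).
  { intros u' v' Hu' Hv'.
    replace (f (triangle a b c u' v') - (f z0 - l * z0 + l * triangle a b c u' v'))%C with
      (f (triangle a b c u' v') - f z0 - l * (triangle a b c u' v' - z0))%C by ring.
    assert (B : Cmod (triangle a b c u' v' - z0) <= s * diam)
      by (apply Cmod_triangle_minus_le; try apply Rabs_le; lra).
    eapply Rle_trans; [apply H; lra | apply Rmult_le_compat_l; lra]. }
  assert (Hlen : forall u' v' u'' v'', u <= u' <= u + s -> u <= u'' <= u + s ->
    v <= v' <= v + s -> v <= v'' <= v + s ->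
    Cmod (triangle a b c u'' v'' - triangle a b c u' v') <= s * diam)
    by (intros; apply Cmod_triangle_minus_le; try apply Rabs_le; lra).
  replace (4 * e * (s * diam) ^ 2) with (4 * (e * (s * diam)) * (s * diam)) by ring.
  apply (Cmod_quad_int_le f (f z0 - l * z0) l);
    (split; [first [apply continuous_on_triangle_row | apply continuous_on_triangle_col]; lra|]);
    (split; [apply Hlen; lra|]); intros t Ht;
    rewrite ?chord_triangle_row, ?chord_triangle_col; apply Hnear; nra.
Qed.

Lemma goursat_triangle : (seg_int f a b + seg_int f b c)%C = seg_int f a c.
Proof.
  assert (Hdiam : 0 <= diam ^ 2) by apply pow2_ge_0.
  assert (Hsmall : forall e, 0 < e ->
    Cmod (triangle_cell_int f a b c 0 0 1) <= 4 * e * (1 * diam) ^ 2).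
  { intros e He.
    apply (square_bisection (fun u v s =>
      Cmod (triangle_cell_int f a b c u v s) <= 4 * e * (s * diam) ^ 2)); [lra| |].
    - intros u v s Hsq Hsw Hse Hnw Hne. rewrite triangle_cell_int_split by auto.
      eapply Rle_trans; [apply Cmod_triangle|].
      eapply Rle_trans; [apply Rplus_le_compat; apply Cmod_triangle|]. lra.
    - intros u v Hu Hv. apply triangle_cell_int_small; lra. }
  assert (Hzero : Cmod (triangle_cell_int f a b c 0 0 1) <= 0).
  { apply le_epsilon. intros e He.
    eapply Rle_trans; [apply (Hsmall (e / (4 * (diam ^ 2 + 1))))|].
    - apply Rdiv_lt_0_compat; lra.
    - replace (4 * (e / (4 * (diam ^ 2 + 1))) * (1 * diam) ^ 2) with
        (e / (diam ^ 2 + 1) * diam ^ 2) by (field; lra).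
      replace (0 + e) with (e / (diam ^ 2 + 1) * (diam ^ 2 + 1)) by (field; lra).
      apply Rmult_le_compat_l; [|lra]. left. apply Rdiv_lt_0_compat; lra. }
  assert (E : triangle_cell_int f a b c 0 0 1 = 0)
    by (apply Cmod_eq_0, Rle_antisym; [exact Hzero | apply Cmod_ge_0]).
  unfold triangle_cell_int, quad_int, triangle in E.
  rewrite !Rplus_0_l, !chord_0, !chord_1, seg_int_point in E.
  apply Ceq_minus. rewrite <- E. ring.
Qed.

End Goursat.

Lemma holo_on_disc_continuous_on_chord (f : C -> C) (q : C) r a b : holo_on_disc f q r ->
  Cmod (a - q) < r -> Cmod (b - q) < r -> continuous_on_chord f a b.
Proof. intros Hf Ha Hb t Ht. now apply ex_C_derive_continuous, Hf, chord_in_disc. Qed.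

Lemma is_C_derive_seg_int (f : C -> C) (q : C) r z : holo_on_disc f q r ->
  Cmod (z - q) < r -> is_C_derive (seg_int f q) z (f z).
Proof.
  intros Hf Hz. apply is_C_derive_iff. intros e He.
  assert (Hq : Cmod (q - q) < r).
  { rewrite Cmod_minus_diag. eapply Rle_lt_trans; [apply Cmod_ge_0 | exact Hz]. }
  assert (Hc := ex_C_derive_continuous f z (Hf z Hz)).
  destruct (proj1 locally_Cmod (Hc _ (locally_Cmod_lt (f z) e He))) as [d [Hd Hnear]].
  apply (filter_imp (fun w => Cmod (w - q) < r /\ Cmod (w - z) < d)).
  2:{ apply filter_and; [now apply locally_Cdisc | now apply locally_Cmod_lt]. }
  intros w [Hw Hwd].
  assert (Hzw := holo_on_disc_continuous_on_chord f q r z w Hf Hz Hw).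
  rewrite <- (goursat_triangle f q z w).
  2:{ intros s t Hs Ht. apply Hf. unfold triangle. auto using chord_in_disc. }
  replace (seg_int f q z + seg_int f z w - seg_int f q z - f z * (w - z))%C with
    (seg_int f z w - (f z * w + 0 * w ^ 2 / 2 - (f z * z + 0 * z ^ 2 / 2)))%C by field.
  apply Cmod_seg_int_minus_affine; [exact Hzw|]. intros t Ht.
  replace (f z + 0 * chord z w t)%C with (f z) by ring.
  left. apply Hnear, chord_in_disc; auto. rewrite Cmod_minus_diag. exact Hd.
Qed.

Lemma locally_seg_int_0 (f : C -> C) (q : C) : locally q (fun z => f z = 0) ->
  locally q (fun z => seg_int f q z = 0).
Proof.
  rewrite !locally_Cmod. intros [e [He Hf]]. exists e. split; auto. intros z Hz.
  assert (Hf0 : forall t, 0 <= t <= 1 -> Cmod (chord q z t - q) < e).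
  { intros t Ht. apply chord_in_disc; auto. now rewrite Cmod_minus_diag. }
  apply Cmod_eq_0, Rle_antisym; [|apply Cmod_ge_0].
  rewrite <- (Rmult_0_l (Cmod (z - q))). apply Cmod_seg_int_le.
  - intros t Ht. apply ex_C_derive_continuous. exists (RtoC 0).
    apply (is_C_derive_ext_loc (fun _ => RtoC 0)); [|apply is_C_derive_const].
    apply (filter_imp (fun w => Cmod (w - q) < e)); [intros w Hw; symmetry; auto|].
    now apply locally_Cdisc, Hf0.
  - intros t Ht. rewrite Hf, Cmod_0 by auto. lra.
Qed.

(** * The maximum principle *)

Lemma continuous_on_max (D : C -> Prop) (phi : C -> R) : closed D ->
  (exists M, forall z, D z -> Cmod z <= M) -> (exists z, D z) -> continuous_on D phi ->
  exists m, D m /\ forall z, D z -> phi z <= phi m.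
Proof.
  intros Hclosed [M HM] [z0 Hz0] Hcont. apply NNPP. intros Hno.
  assert (Hlarger : forall z, D z -> exists w, D w /\ phi z < phi w).
  { intros z Hz. apply NNPP. intros Hnow. apply Hno. exists z. split; auto.
    intros w Hw. apply Rnot_lt_le. eauto. }
  assert (Hmax2 : forall w w', D w -> D w' -> exists v, D v /\ phi w <= phi v /\ phi w' <= phi v).
  { intros w w' Hw Hw'. destruct (Rle_dec (phi w) (phi w')); [exists w' | exists w];
      repeat split; auto; lra. }
  assert (HM0 : 0 <= M) by (eapply Rle_trans; [apply Cmod_ge_0 | now apply (HM z0)]).
  destruct (square_bisection (fun x y s => exists w, D w /\ forall z, D z ->
    x <= Re z <= x + s -> y <= Im z <= y + s -> phi z < phi w) (- M) (- M) (2 * M))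
    as [w [Hw Hlt]]; [lra | | |].
  - intros x y s _ [sw [Dsw Hsw]] [se [Dse Hse]] [nw [Dnw Hnw]] [ne [Dne Hne]].
    destruct (Hmax2 sw se) as [south [Dsouth Hsouth]]; auto.
    destruct (Hmax2 nw ne) as [north [Dnorth Hnorth]]; auto.
    destruct (Hmax2 south north) as [w [Dw Hw]]; auto. exists w. split; auto. intros z Hz Hx Hy.
    destruct (Rle_dec (Re z) (x + s / 2)), (Rle_dec (Im z) (y + s / 2)).
    + specialize (Hsw z Hz ltac:(lra) ltac:(lra)). lra.
    + specialize (Hnw z Hz ltac:(lra) ltac:(lra)). lra.
    + specialize (Hse z Hz ltac:(lra) ltac:(lra)). lra.
    + specialize (Hne z Hz ltac:(lra) ltac:(lra)). lra.
  - intros u v _ _.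
    assert (Hloc : exists w, D w /\ locally ((u, v) : C) (fun z => D z -> phi z < phi w)).
    { destruct (classic (D (u, v))) as [Huv|Huv].
      - destruct (Hlarger _ Huv) as [w [Hw Hlt]]. exists w. split; auto.
        apply (Hcont _ Huv (fun y => y < phi w)). now apply open_lt.
      - exists z0. split; auto.
        apply (filter_imp (fun z => ~ D z)); [tauto|].
        apply NNPP. intros H. now apply Huv, Hclosed. }
    destruct Hloc as [w [Hw [d Hd]]]. exists d. split; [apply cond_pos|].
    intros x y s _ Hs Hu Hv. exists w. split; auto. intros z Hz Hx Hy. apply Hd; auto.
    split; apply Rabs_def1; unfold minus, plus, opp, Re, Im in *; simpl in *; lra.
  - assert (B := HM w Hw). assert (B1 := re_le_Cmod w).
    assert (B2 := Rle_trans _ _ _ (Rmax_r _ _) (Rmax_Cmod w)).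
    apply Rabs_le_between in B1. apply Rabs_le_between in B2.
    specialize (Hlt w Hw ltac:(lra) ltac:(unfold Im; lra)). lra.
Qed.

Lemma continuous_Cmod_minus (q z : C) : continuous (fun w => Cmod (w - q)) z.
Proof.
  intros P [e He]. apply locally_Cmod. exists e. split; [apply cond_pos|].
  intros w Hw. apply He. eapply Rle_lt_trans; [|exact Hw]. apply Rabs_le.
  assert (Hzw := Cmod_minus_triangle w z q). assert (Hwz := Cmod_minus_triangle z w q).
  rewrite (Cmod_minus_sym z w) in Hzw. unfold minus, plus, opp; simpl; lra.
Qed.

Lemma locally_neq (q z : C) : z <> q -> locally z (fun w => w <> q).
Proof.
  intros Hz. apply (filter_imp (fun w => 0 < Cmod (w - q))).
  - intros w Hw ->. rewrite Cmod_minus_diag in Hw. lra.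
  - apply (continuous_Cmod_minus q z (fun y => 0 < y)), open_gt.
    now apply Cmod_gt_0, Cminus_eq_contra.
Qed.

Lemma closed_disc_max (q : C) r (phi : C -> R) : 0 <= r ->
  (forall z, Cmod (z - q) <= r -> continuous phi z) ->
  exists m, Cmod (m - q) <= r /\ forall z, Cmod (z - q) <= r -> phi z <= phi m.
Proof.
  intros Hr Hphi. apply continuous_on_max.
  - intros z Hz. apply Rnot_lt_le. intros Hlt. apply Hz.
    apply (filter_imp (fun w => r < Cmod (w - q))); [intros w; apply Rlt_not_le|].
    apply (continuous_Cmod_minus q z (fun y => r < y)). now apply open_gt.
  - exists (r + Cmod q). intros z Hz.
    replace z with (z - q + q)%C by ring. eapply Rle_trans; [apply Cmod_triangle | lra].
  - exists q. now rewrite Cmod_minus_diag.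
  - now apply continuous_on_forall.
Qed.

Lemma second_derivative_test (phi phi1 : R -> R) x d :
  locally x (fun y => is_derive phi y (phi1 y)) -> is_derive phi1 x d ->
  locally x (fun y => phi y <= phi x) -> d <= 0.
Proof.
  intros Hphi Hphi1 Hmax. apply Rnot_lt_le. intros Hd.
  destruct (proj1 locally_R (filter_and _ _ Hphi Hmax)) as [eta [Heta Hnear]].
  assert (Hder : forall y, x - eta < y < x + eta -> derivable_pt_lim phi y (phi1 y))
    by (intros y Hy; apply is_derive_Reals; now apply Hnear).
  assert (Hle : forall y, x - eta < y < x + eta -> phi y <= phi x)
    by (intros y Hy; now apply Hnear).
  assert (Hcrit : phi1 x = 0).
  { apply (deriv_maximum phi (x - eta) (x + eta) x (exist _ _ (Hder x ltac:(lra)))); try lra.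
    intros y Hy Hy'. apply Hle. lra. }
  apply is_derive_Reals in Hphi1. destruct (Hphi1 d Hd) as [delta Hdelta].
  assert (Hdelta0 := cond_pos delta).
  set (h := Rmin delta eta / 2).
  assert (Hh : 0 < h /\ h < delta /\ h < eta).
  { assert (Hmin_l := Rmin_l delta eta). assert (Hmin_r := Rmin_r delta eta).
    assert (0 < Rmin delta eta) by (apply Rmin_glb_lt; lra). unfold h. lra. }
  destruct (MVT_cor2 phi phi1 x (x + h)) as [xi [Exi Hxi]]; [lra | |].
  - intros y Hy. apply Hder. lra.
  - assert (G := Hdelta (xi - x) ltac:(lra) ltac:(apply Rabs_def1; lra)).
    replace (x + (xi - x)) with xi in G by ring. rewrite Hcrit, Rminus_0_r in G.
    apply Rabs_def2 in G. assert (Hpos : 0 < phi1 xi / (xi - x)) by lra.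
    assert (0 < phi1 xi).
    { replace (phi1 xi) with (phi1 xi / (xi - x) * (xi - x)) by (field; lra).
      apply Rmult_lt_0_compat; lra. }
    assert (G' := Hle (x + h) ltac:(lra)). nra.
Qed.

Lemma is_derive_Re_chord (f : C -> C) (a b l : C) t : is_C_derive f (chord a b t) l ->
  is_derive (fun s => Re (f (chord a b s))) t (Re (l * (b - a))).
Proof.
  intros Hf. apply is_C_derive_chord in Hf.
  refine (filterdiff_comp' (V := C_R_NormedModule) (W := R_NormedModule) _ Re t _ Re Hf _).
  apply filterdiff_linear, is_linear_fst.
Qed.

Definition ex_C_derive2 (f : C -> C) (z : C) : Prop :=
  exists f1, locally z (fun w => is_C_derive f w (f1 w)) /\ ex_C_derive f1 z.

Lemma ex_C_derive2_continuous (f : C -> C) (z : C) : ex_C_derive2 f z -> continuous f z.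
Proof.
  intros [f1 [H _]]. apply ex_C_derive_continuous. exists (f1 z). exact (locally_singleton _ _ H).
Qed.

Lemma ex_C_derive2_ext_loc (f g : C -> C) (z : C) : locally z (fun w => f w = g w) ->
  ex_C_derive2 f z -> ex_C_derive2 g z.
Proof.
  intros Hfg [f1 [Hf1 Hf2]]. exists f1. split; auto.
  apply (filter_imp (fun w => locally w (fun w => f w = g w) /\ is_C_derive f w (f1 w))).
  - intros w [Hw Hf]. now apply (is_C_derive_ext_loc f).
  - apply filter_and; [now apply locally_locally | exact Hf1].
Qed.

Lemma ex_C_derive2_const (c z : C) : ex_C_derive2 (fun _ => c) z.
Proof.
  exists (fun _ => RtoC 0). split.
  - apply filter_forall. intros w. apply is_C_derive_const.
  - exists (RtoC 0). apply is_C_derive_const.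
Qed.

Lemma ex_C_derive2_mult (f g : C -> C) (z : C) : ex_C_derive2 f z -> ex_C_derive2 g z ->
  ex_C_derive2 (fun w => f w * g w)%C z.
Proof.
  intros [f1 [Hf [f2 Hf1]]] [g1 [Hg [g2 Hg1]]]. exists (fun w => f1 w * g w + f w * g1 w)%C. split.
  - apply (filter_imp _ _ (fun w Hw => is_C_derive_mult f g w _ _ (proj1 Hw) (proj2 Hw))).
    now apply filter_and.
  - apply locally_singleton in Hf, Hg. eexists.
    apply is_C_derive_plus; apply is_C_derive_mult; eassumption.
Qed.

Lemma is_C_derive_inv_minus (q z : C) : z <> q ->
  is_C_derive (fun w => / (w - q))%C z (- (/ (z - q) * / (z - q)))%C.
Proof.
  intros Hz. rewrite <- (Cmult_1_l (- _)).
  apply (is_C_derive_comp Cinv (fun w => w - q)%C); [|apply is_C_derive_minus_const].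
  now apply is_C_derive_inv, Cminus_eq_contra.
Qed.

Lemma ex_C_derive2_inv_minus (q z : C) : z <> q -> ex_C_derive2 (fun w => / (w - q))%C z.
Proof.
  intros Hz. exists (fun w => - (/ (w - q) * / (w - q)))%C. split.
  - apply (filter_imp (fun w => w <> q)); [intros w; apply is_C_derive_inv_minus|].
    now apply locally_neq.
  - eexists. apply (is_C_derive_ext_loc (fun w => 0 - / (w - q) * / (w - q))%C).
    + apply filter_forall. intros w. ring.
    + apply is_C_derive_minus; [apply is_C_derive_const|].
      apply is_C_derive_mult; now apply is_C_derive_inv_minus.
Qed.

Lemma Re_derive2_le_at_local_max (f f1 : C -> C) (q m f2 v : C) e : Cmod v = 1 ->
  locally m (fun z => is_C_derive f z (f1 z)) -> is_C_derive f1 m f2 ->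
  locally m (fun z => Re (f z) + e * Cmod (z - q) ^ 2 <= Re (f m) + e * Cmod (m - q) ^ 2) ->
  Re (f2 * v * v) + 2 * e <= 0.
Proof.
  intros Hv Hf Hf1 Hmax.
  set (B := Re (m - q) * Re v + Im (m - q) * Im v).
  assert (Hpull : forall P, locally m P -> locally 0 (fun t => P (chord m (m + v) t))).
  { intros P HP. rewrite <- (chord_0 m (m + v)) in HP.
    exact (continuous_chord (fun z => z) m (m + v) 0 (fun Q HQ => HQ) P HP). }
  assert (Hsq : forall t, Cmod (chord m (m + v) t - q) ^ 2 = Cmod (m - q) ^ 2 + 2 * B * t + t ^ 2).
  { intros t. assert (E : Re v ^ 2 + Im v ^ 2 = 1) by (rewrite <- Cmod2_alt, Hv; ring).
    rewrite !Cmod2_alt, <- (Rmult_1_r (t ^ 2)), <- E. unfold B, chord.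
    destruct m, v, q. simpl. ring. }
  assert (Hder : forall g t l, is_C_derive g (chord m (m + v) t) l ->
    is_derive (fun t => Re (g (chord m (m + v) t))) t (Re (l * v))).
  { intros g t l Hg. assert (D := is_derive_Re_chord g m (m + v) l t Hg).
    now replace (m + v - m)%C with v in D by ring. }
  apply (second_derivative_test
    (fun t => Re (f (chord m (m + v) t)) + e * (Cmod (m - q) ^ 2 + 2 * B * t + t ^ 2))
    (fun t => Re (f1 (chord m (m + v) t) * v) + 2 * e * (B + t)) 0).
  - apply (filter_imp (fun t => is_C_derive f (chord m (m + v) t) (f1 (chord m (m + v) t)))).
    2: exact (Hpull _ Hf).
    intros t Ht. apply (is_derive_plus (fun t => Re (f (chord m (m + v) t)))); [now apply Hder|].
    auto_derive; auto. ring.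
  - apply (is_derive_plus (fun t => Re (f1 (chord m (m + v) t) * v))).
    + replace (f2 * v)%C with (f2 * v + f1 m * 0)%C by ring.
      apply (Hder (fun z => f1 z * v)%C). rewrite chord_0.
      apply is_C_derive_mult; [exact Hf1 | apply is_C_derive_const].
    + auto_derive; auto. ring.
  - rewrite <- Hsq, chord_0.
    apply (filter_imp (fun t => Re (f (chord m (m + v) t)) + e * Cmod (chord m (m + v) t - q) ^ 2
      <= Re (f m) + e * Cmod (m - q) ^ 2)); [intros t; now rewrite Hsq | exact (Hpull _ Hmax)].
Qed.

(* The real part of f is harmonic, so Re f + e |z - q|^2 has Laplacian 4 e > 0. *)
Lemma no_local_max_Re_plus_square (f : C -> C) (q m : C) e : 0 < e -> ex_C_derive2 f m ->
  ~ locally m (fun z => Re (f z) + e * Cmod (z - q) ^ 2 <= Re (f m) + e * Cmod (m - q) ^ 2).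
Proof.
  intros He [f1 [Hf [f2 Hf1]]] Hmax.
  assert (H1 := Re_derive2_le_at_local_max f f1 q m f2 1 e Cmod_1 Hf Hf1 Hmax).
  assert (HCi := Re_derive2_le_at_local_max f f1 q m f2 Ci e Cmod_Ci Hf Hf1 Hmax).
  destruct f2 as [x y]. simpl in H1, HCi. lra.
Qed.

Lemma max_principle_Re (f : C -> C) (q : C) r B :
  (forall z, Cmod (z - q) <= r -> ex_C_derive2 f z) ->
  (forall z, Cmod (z - q) = r -> Re (f z) <= B) ->
  forall z, Cmod (z - q) <= r -> Re (f z) <= B.
Proof.
  intros Hf HB z Hz. apply Rnot_lt_le. intros Hlt.
  assert (Hr : 0 <= r) by (eapply Rle_trans; [apply Cmod_ge_0 | exact Hz]).
  set (e := (Re (f z) - B) / (r ^ 2 + 1)).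
  assert (Hr2 : 0 <= r ^ 2) by apply pow2_ge_0.
  assert (He : 0 < e) by (apply Rdiv_lt_0_compat; lra).
  assert (Her : e * r ^ 2 < Re (f z) - B).
  { replace (Re (f z) - B) with (e * (r ^ 2 + 1)) by (unfold e; field; lra). lra. }
  destruct (closed_disc_max q r (fun w => Re (f w) + e * Cmod (w - q) ^ 2) Hr) as [m [Hm Hmax]].
  { intros w Hw. apply (continuous_plus (V := R_NormedModule) (fun w => Re (f w))).
    - apply continuous_comp; [now apply ex_C_derive2_continuous, Hf|].
      destruct (f w). apply continuous_fst.
    - apply (continuous_comp (fun w => Cmod (w - q)) (fun x => e * x ^ 2)).
      + apply continuous_Cmod_minus.
      + apply (ex_derive_continuous (fun x => e * x ^ 2)). auto_derive; auto. }
  destruct (Rle_lt_or_eq_dec _ _ Hm) as [Hin|Hbd].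
  - apply (no_local_max_Re_plus_square f q m e He (Hf m Hm)).
    apply (filter_imp (fun w => Cmod (w - q) < r)); [|now apply locally_Cdisc].
    intros w Hw. apply Hmax. lra.
  - specialize (HB m Hbd). specialize (Hmax z Hz). simpl in Hmax. rewrite Hbd in Hmax.
    assert (0 <= e * Cmod (z - q) ^ 2) by (apply Rmult_le_pos; [lra | apply pow2_ge_0]).
    simpl in *. lra.
Qed.

Lemma ex_unit_Cmult_Cmod (z : C) : exists c, Cmod c = 1 /\ (c * z)%C = Cmod z.
Proof.
  destruct (Ceq_dec z 0) as [->|Hz].
  - exists 1. rewrite Cmod_0, Cmult_0_r. split; [apply Cmod_1 | reflexivity].
  - assert (Hm : RtoC (Cmod z) <> 0) by (intros E; apply Hz, Cmod_eq_0, RtoC_inj, E).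
    exists (Cconj z / Cmod z)%C. split.
    + rewrite Cmod_div, Cmod_conj, Cmod_R, Rabs_pos_eq by (auto; apply Cmod_ge_0).
      field. intros E. apply Hm. now rewrite E.
    + replace (Cconj z / Cmod z * z)%C with (z * Cconj z / Cmod z)%C by (now field).
      rewrite <- Cmod2_conj, RtoC_pow. now field.
Qed.

Lemma max_principle (f : C -> C) (q : C) r B :
  (forall z, Cmod (z - q) <= r -> ex_C_derive2 f z) ->
  (forall z, Cmod (z - q) = r -> Cmod (f z) <= B) ->
  forall z, Cmod (z - q) <= r -> Cmod (f z) <= B.
Proof.
  intros Hf HB z Hz. destruct (ex_unit_Cmult_Cmod (f z)) as [c [Hc Hcz]].
  replace (Cmod (f z)) with (Re (c * f z)) by (rewrite Hcz; apply re_RtoC).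
  apply (max_principle_Re (fun w => c * f w)%C q r); auto.
  - intros w Hw. apply ex_C_derive2_mult; [apply ex_C_derive2_const | auto].
  - intros w Hw. eapply Rle_trans; [apply Rle_abs|]. eapply Rle_trans; [apply re_le_Cmod|].
    rewrite Cmod_mult, Hc, Rmult_1_l. auto.
Qed.

(** * The identity theorem *)

Lemma ex_C_derive2_mult_inv_pow (f : C -> C) (q z : C) n :
  locally q (fun w => f w = 0) -> ex_C_derive2 f z ->
  ex_C_derive2 (fun w => f w * (/ (w - q)) ^ n)%C z.
Proof.
  intros Hf0 Hf. destruct (Ceq_dec z q) as [->|Hz].
  - apply (ex_C_derive2_ext_loc (fun _ => RtoC 0)); [|apply ex_C_derive2_const].
    apply (filter_imp (fun w => f w = 0)); [|exact Hf0].
    intros w ->. now rewrite Cmult_0_l.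
  - apply ex_C_derive2_mult; [exact Hf|]. induction n as [|n IH].
    + exact (ex_C_derive2_const 1 z).
    + apply (ex_C_derive2_mult (fun w => / (w - q))%C); [|exact IH].
      now apply ex_C_derive2_inv_minus.
Qed.

Lemma eq_0_of_geometric_bound (x B y : R) : 0 <= x -> 0 <= y < 1 ->
  (forall n, x <= B * y ^ n) -> x = 0.
Proof.
  intros Hx Hy HB. apply Rle_antisym; [|exact Hx].
  apply (is_lim_seq_le (fun _ => x) (fun n => B * y ^ n) x 0 HB); [apply is_lim_seq_const|].
  replace (Finite 0) with (Rbar_mult B 0) by (simpl; f_equal; ring).
  apply is_lim_seq_scal_l, is_lim_seq_geom. rewrite Rabs_pos_eq; lra.
Qed.

(* The maximum principle for f / (z - q)^n bounds |f z| by a multiple of (|z - q| / r)^n. *)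
Lemma ex_C_derive2_vanish (f : C -> C) (q z : C) r :
  (forall w, Cmod (w - q) <= r -> ex_C_derive2 f w) -> locally q (fun w => f w = 0) ->
  Cmod (z - q) < r -> f z = 0.
Proof.
  intros Hf Hf0 Hz.
  assert (Hr : 0 < r) by (eapply Rle_lt_trans; [apply Cmod_ge_0 | exact Hz]).
  destruct (Ceq_dec z q) as [->|Hzq]; [exact (locally_singleton _ _ Hf0)|].
  destruct (closed_disc_max q r (fun w => Cmod (f w - 0))) as [m [_ Hm]]; [lra | |].
  { intros w Hw. apply (continuous_comp f (fun y => Cmod (y - 0))).
    - now apply ex_C_derive2_continuous, Hf.
    - apply continuous_Cmod_minus. }
  apply Cmod_eq_0, (eq_0_of_geometric_bound _ (Cmod (f m - 0)) (Cmod (z - q) / r)).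
  - apply Cmod_ge_0.
  - split; [apply Rdiv_le_0_compat; [apply Cmod_ge_0 | lra]|].
    apply (Rmult_lt_reg_r r); auto.
    replace (Cmod (z - q) / r * r) with (Cmod (z - q)) by (field; lra). lra.
  - intros n.
    assert (Hzq' : (z - q)%C <> 0) by now apply Cminus_eq_contra.
    assert (Hzq0 : 0 < Cmod (z - q)) by now apply Cmod_gt_0.
    assert (G : Cmod (f z * (/ (z - q)) ^ n) <= Cmod (f m - 0) * (/ r) ^ n).
    { apply (max_principle (fun w => f w * (/ (w - q)) ^ n)%C q r); [| |lra].
      - intros w Hw. apply ex_C_derive2_mult_inv_pow; auto.
      - intros w Hw. rewrite Cmod_mult, Cmod_pow, Cmod_inv, Hw by (apply Cmod_gt_0; lra).
        apply Rmult_le_compat_r; [apply pow_le; left; now apply Rinv_0_lt_compat|].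
        replace (f w) with (f w - 0)%C by ring. apply Hm. lra. }
    rewrite Cmod_mult, Cmod_pow, Cmod_inv in G by auto.
    apply (Rmult_le_compat_r (Cmod (z - q) ^ n)) in G; [|apply pow_le; lra].
    rewrite !Rmult_assoc, <- !Rpow_mult_distr, Rinv_l, pow1, Rmult_1_r in G by lra.
    now rewrite (Rmult_comm (/ r)) in G.
Qed.

Lemma is_C_derive_locally_0 (f : C -> C) (z l : C) :
  is_C_derive f z l -> locally z (fun w => f w = 0) -> l = 0.
Proof.
  intros Hf Hf0. rewrite <- (is_C_derive_unique f z l Hf).
  apply is_C_derive_unique, (is_C_derive_ext_loc (fun _ => RtoC 0)); [|apply is_C_derive_const].
  revert Hf0. apply filter_imp. auto.
Qed.

Lemma holo_on_disc_vanish (f : C -> C) (q : C) r : holo_on_disc f q r ->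
  locally q (fun z => f z = 0) -> forall z, Cmod (z - q) < r -> f z = 0.
Proof.
  intros Hf Hf0.
  set (F := seg_int f q). set (G := seg_int F q).
  assert (HF : forall z, Cmod (z - q) < r -> is_C_derive F z (f z))
    by (intros z; now apply is_C_derive_seg_int).
  assert (HG : forall z, Cmod (z - q) < r -> is_C_derive G z (F z)).
  { intros z. apply is_C_derive_seg_int. intros w Hw. eexists. now apply HF. }
  assert (Hzero_derive : forall K L : C -> C,
    (forall z, Cmod (z - q) < r -> is_C_derive K z (L z)) ->
    (forall z, Cmod (z - q) < r -> K z = 0) -> forall z, Cmod (z - q) < r -> L z = 0).
  { intros K L HKL HK z Hz. apply (is_C_derive_locally_0 K z); auto.
    apply (filter_imp (fun w => Cmod (w - q) < r)); auto. now apply locally_Cdisc. }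
  apply (Hzero_derive F f HF), (Hzero_derive G F HG). intros z Hz.
  apply (ex_C_derive2_vanish G q z ((Cmod (z - q) + r) / 2)); [| |lra].
  - intros w Hw. exists F. split.
    + apply (filter_imp (fun v => Cmod (v - q) < r)); [exact HG | apply locally_Cdisc; lra].
    + exists (f w). apply HF. lra.
  - now apply locally_seg_int_0, locally_seg_int_0.
Qed.

(** * Germs and their continuation along a path *)

Definition germ_eq (p : C) (f g : C -> C) : Prop := locally p (fun z => f z = g z).

#[local] Instance germ_eq_equivalence (p : C) : Equivalence (germ_eq p).
Proof.
  split; [intros f | intros f g | intros f g h]; unfold germ_eq.
  - now apply filter_forall.
  - apply filter_imp. auto.
  - intros Hfg Hgh. apply (filter_imp (fun z => f z = g z /\ g z = h z)).
    + intros z [-> ->]. reflexivity.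
    + now apply filter_and.
Qed.

Definition holomorphic_at (f : C -> C) (p : C) : Prop := locally p (fun z => ex_C_derive f z).

Lemma holomorphic_at_iff {f : C -> C} {p : C} :
  holomorphic_at f p <-> exists r, 0 < r /\ holo_on_disc f p r.
Proof. apply locally_Cmod. Qed.

Lemma holo_on_disc_holomorphic_at (f : C -> C) (c p : C) r : holo_on_disc f c r ->
  Cmod (p - c) < r -> holomorphic_at f p.
Proof. intros Hf Hp. exact (filter_imp _ _ Hf (locally_Cdisc Hp)). Qed.

Lemma identity_theorem (f g : C -> C) (p : C) : holomorphic_at f p -> holomorphic_at g p ->
  locally p (fun q => germ_eq q f g -> germ_eq p f g).
Proof.
  intros Hf Hg. destruct (proj1 locally_Cmod (filter_and _ _ Hf Hg)) as [r [Hr Hfg]].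
  apply (filter_imp (fun q => Cmod (q - p) < r / 2)); [|apply locally_Cmod_lt; lra].
  intros q Hq. unfold germ_eq. intros Hqfg.
  apply (filter_imp (fun z => Cmod (z - q) < r / 2)).
  2:{ apply locally_Cdisc. now rewrite Cmod_minus_sym. }
  intros z Hz. apply Ceq_minus.
  apply (holo_on_disc_vanish (fun z => f z - g z)%C q (r / 2)); auto.
  - intros w Hw. assert (T := Cmod_minus_triangle q w p).
    destruct (Hfg w ltac:(lra)) as [[l Hl] [m Hm]]. exists (l - m)%C. now apply is_C_derive_minus.
  - revert Hqfg. apply filter_imp. intros w. apply Ceq_minus.
Qed.

Lemma interval_induction (P : R -> Prop) s t : s <= t -> P s ->
  (forall u, s <= u <= t -> locally u (fun v => s <= v <= t ->
    (v <= u -> P v -> P u) /\ (u <= v -> P u -> P v))) ->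
  P t.
Proof.
  intros Hst Hs Hloc.
  destruct (completeness (fun u => s <= u <= t /\ P u)) as [m [Hub Hlub]].
  - exists t. intros u [Hu _]. lra.
  - exists s. split; auto; lra.
  - assert (Hm : s <= m <= t).
    { split; [apply Hub; split; auto; lra|]. apply Hlub. intros u [Hu _]. lra. }
    destruct (proj1 locally_R (Hloc m Hm)) as [d [Hd Hnear]].
    assert (HPm : P m).
    { apply NNPP. intros HPm. assert (m <= m - d / 2); [|lra].
      apply Hlub. intros u [Hu HPu]. apply Rnot_lt_le. intros Hlt.
      assert (Hum : u <= m) by (apply Hub; auto).
      apply HPm, (Hnear u); auto; lra. }
    destruct (Rle_lt_dec t m) as [Htm|Htm]; [now replace t with m by lra|].
    set (v := Rmin t (m + d / 2)).
    assert (Hv : m < v <= t /\ v <= m + d / 2).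
    { split; [split|]; [apply Rmin_glb_lt; lra | apply Rmin_l | apply Rmin_r]. }
    assert (HPv : P v) by (apply (Hnear v); auto; lra).
    assert (v <= m) by (apply Hub; split; auto; lra). lra.
Qed.

Definition continuous_on_itv (gamma : R -> C) (s t : R) : Prop :=
  continuous_on (fun u => s <= u <= t) gamma.

Lemma continuous_on_itv_sub (gamma : R -> C) s t s' t' : s <= s' -> t' <= t ->
  continuous_on_itv gamma s t -> continuous_on_itv gamma s' t'.
Proof. intros Hs Ht. apply continuous_on_subset. intros u. lra. Qed.

Lemma continuous_on_itv_locally {gamma : R -> C} {s t u} {P : C -> Prop} :
  continuous_on_itv gamma s t -> s <= u <= t -> locally (gamma u) P ->
  locally u (fun v => s <= v <= t -> P (gamma v)).
Proof. intros Hc Hu. exact (Hc u Hu P). Qed.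

Definition germ_family (gamma : R -> C) (s t : R) (f : R -> C -> C) : Prop :=
  forall u, s <= u <= t -> holomorphic_at (f u) (gamma u) /\
    locally u (fun v => s <= v <= t -> germ_eq (gamma v) (f v) (f u)).

Definition is_germ_of (a : nat -> C) (f : C -> C) : Prop :=
  locally (RtoC 0) (fun z => @is_series C_AbsRing C_NormedModule (fun n => a n * Cpow z n)%C (f z)).

Lemma is_germ_of_unique (a : nat -> C) (f g : C -> C) :
  is_germ_of a f -> is_germ_of a g -> germ_eq 0 f g.
Proof.
  unfold germ_eq. intros Hf Hg. generalize (filter_and _ _ Hf Hg).
  apply filter_imp. intros z [Hfz Hgz].
  exact (@filterlim_locally_unique nat C_AbsRing C_NormedModule eventually _ _ _ _ Hfz Hgz).
Qed.

(* The radii demanded by [continuable_along] can be chosen freely, as gamma is continuous. *)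
Lemma continuable_alongE (a : nat -> C) (gamma : R -> C) T : continuous_on_itv gamma 0 T ->
  continuable_along a gamma T <-> exists f, germ_family gamma 0 T f /\ is_germ_of a (f 0).
Proof.
  intros Hgamma. split.
  - intros [f [r [Hholo [Hgerm Hcomp]]]]. exists f. split.
    + intros u Hu. split; [apply holomorphic_at_iff; exists (r u); now apply Hholo|].
      destruct (Hcomp u Hu) as [d [Hd H]]. exists (mkposreal d Hd). intros v Hvu Hv.
      apply locally_Cmod. now apply H.
    + apply locally_Cmod. destruct Hgerm as [e [He H]]. exists e. split; auto.
      intros z Hz. apply H. now replace z with (z - 0)%C by ring.
  - intros [f [Hfam Hgerm]].
    destruct (functional_choice (fun u r => 0 <= u <= T -> 0 < r /\ holo_on_disc (f u) (gamma u) r))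
      as [r Hr].
    { intros u. destruct (classic (0 <= u <= T)) as [Hu|Hu]; [|exists 0; tauto].
      destruct (proj1 holomorphic_at_iff (proj1 (Hfam u Hu))) as [r Hr]. now exists r. }
    exists f, r. split; [exact Hr | split].
    + destruct (proj1 locally_Cmod Hgerm) as [e [He H]]. exists e. split; auto.
      intros z Hz. apply H. now replace (z - 0)%C with z by ring.
    + intros u Hu. destruct (Hr u Hu) as [Hru _].
      destruct (filter_and _ _
        (continuous_on_itv_locally Hgamma Hu (locally_Cmod_lt (gamma u) (r u) Hru))
        (proj2 (Hfam u Hu))) as [d H].
      exists d. split; [apply cond_pos|]. intros v Hv Hvu.
      destruct (H v Hvu) as [Hin Heq].
      split; [exact (Hin Hv) | exact (proj1 locally_Cmod (Heq Hv))].
Qed.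

Lemma germ_family_sub (gamma : R -> C) s t s' t' f : s <= s' -> t' <= t ->
  germ_family gamma s t f -> germ_family gamma s' t' f.
Proof.
  intros Hs Ht Hf u Hu. destruct (Hf u ltac:(lra)) as [Hhol Hcomp]. split; auto.
  revert Hcomp. apply filter_imp. intros v H Hv. apply H. lra.
Qed.

Lemma germ_family_ext (gamma gamma' : R -> C) s t f :
  (forall u, s <= u <= t -> gamma u = gamma' u) ->
  germ_family gamma s t f -> germ_family gamma' s t f.
Proof.
  intros E Hf u Hu. destruct (Hf u Hu) as [Hhol Hcomp]. rewrite <- E by auto. split; auto.
  revert Hcomp. apply filter_imp. intros v H Hv. rewrite <- E; auto.
Qed.

Lemma germ_family_reparam (gamma : R -> C) s t f a b : 0 <= b ->
  germ_family gamma (a + b * s) (a + b * t) f ->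
  germ_family (fun x => gamma (a + b * x)) s t (fun x => f (a + b * x)).
Proof.
  intros Hb Hf.
  assert (Hmono : forall u, s <= u <= t -> a + b * s <= a + b * u <= a + b * t) by (intros; nra).
  intros u Hu. destruct (Hf _ (Hmono u Hu)) as [Hhol Hcomp]. split; auto.
  assert (Hc : continuous (fun x => a + b * x) u)
    by (apply (ex_derive_continuous (fun x => a + b * x)); auto_derive; auto).
  generalize (Hc _ Hcomp). apply (filter_imp (F := locally u)). intros v H Hv. now apply H, Hmono.
Qed.

Lemma germ_family_const (gamma : R -> C) s t h : continuous_on_itv gamma s t ->
  (forall u, s <= u <= t -> holomorphic_at h (gamma u)) -> germ_family gamma s t (fun _ => h).
Proof. intros Hc Hh u Hu. split; auto. apply filter_forall. reflexivity. Qed.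

Definition glue {A : Type} (t : R) (f g : R -> A) (x : R) : A := if Rle_dec x t then f x else g x.

Lemma glue_left {A : Type} t (f g : R -> A) x : x <= t -> glue t f g x = f x.
Proof. intros H. unfold glue. now destruct (Rle_dec x t). Qed.

Lemma glue_right {A : Type} t (f g : R -> A) x : f t = g t -> t <= x -> glue t f g x = g x.
Proof.
  intros E H. unfold glue. destruct (Rle_dec x t); auto. now replace x with t by lra.
Qed.

Lemma germ_family_glue (gamma : R -> C) s t u f g : s <= t <= u -> continuous_on_itv gamma s u ->
  germ_family gamma s t f -> germ_family gamma t u g -> germ_eq (gamma t) (f t) (g t) ->
  germ_family gamma s u (glue t f g).
Proof.
  intros Hst Hc Hf Hg Hfg x Hx. unfold glue.
  destruct (Rtotal_order x t) as [Hxt|[->|Hxt]].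
  - destruct (Rle_dec x t); [|lra]. destruct (Hf x ltac:(lra)) as [Hhol Hcomp]. split; auto.
    generalize (filter_and _ _ Hcomp (open_lt t x Hxt)). apply filter_imp. intros v [H Hvt] Hv.
    destruct (Rle_dec v t); [apply H|]; lra.
  - destruct (Rle_dec t t); [|lra].
    destruct (Hf t ltac:(lra)) as [Hhol Hfcomp]. destruct (Hg t ltac:(lra)) as [_ Hgcomp].
    split; auto.
    generalize (filter_and _ _ Hfcomp (filter_and _ _ Hgcomp
      (continuous_on_itv_locally Hc Hx (locally_locally _ _ Hfg)))).
    apply filter_imp. intros v [Hvf [Hvg Hvfg]] Hv.
    destruct (Rle_dec v t); [apply Hvf; lra|].
    transitivity (g t); [apply Hvg; lra | symmetry; now apply Hvfg].
  - destruct (Rle_dec x t); [lra|]. destruct (Hg x ltac:(lra)) as [Hhol Hcomp]. split; auto.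
    generalize (filter_and _ _ Hcomp (open_gt t x Hxt)). apply filter_imp. intros v [H Hvt] Hv.
    destruct (Rle_dec v t); [|apply H]; lra.
Qed.

Lemma germ_family_unique (gamma : R -> C) s t f g : s <= t -> continuous_on_itv gamma s t ->
  germ_family gamma s t f -> germ_family gamma s t g ->
  germ_eq (gamma s) (f s) (g s) -> germ_eq (gamma t) (f t) (g t).
Proof.
  intros Hst Hc Hf Hg Hs.
  apply (interval_induction (fun u => germ_eq (gamma u) (f u) (g u)) s t Hst Hs).
  intros u Hu. destruct (Hf u Hu) as [Hfu Hfv]. destruct (Hg u Hu) as [Hgu Hgv].
  assert (Hback := continuous_on_itv_locally Hc Hu (identity_theorem _ _ _ Hfu Hgu)).
  assert (Hforth : locally u (fun v => s <= v <= t -> germ_eq (gamma u) (f u) (g u) ->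
    germ_eq (gamma v) (f u) (g u))).
  { destruct (classic (germ_eq (gamma u) (f u) (g u))) as [Hfg|Hfg];
      [|apply filter_forall; tauto].
    generalize (continuous_on_itv_locally Hc Hu (locally_locally _ _ Hfg)).
    apply filter_imp. intros v H Hv _. exact (H Hv). }
  generalize (filter_and _ _ (filter_and _ _ Hfv Hgv) (filter_and _ _ Hback Hforth)).
  apply filter_imp. intros v [[Hfvu Hgvu] [Hvu Huv]] Hv.
  specialize (Hfvu Hv). specialize (Hgvu Hv).
  split; intros _ H.
  - apply Hvu; auto. transitivity (f v); [now symmetry|]. now transitivity (g v).
  - transitivity (f u); auto. transitivity (g u); [auto | now symmetry].
Qed.

(** * Lengths of paths *)

Definition lipschitz_with (K : R) (gamma : R -> C) (s t : R) : Prop :=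
  forall u v, s <= u <= t -> s <= v <= t -> Cmod (gamma u - gamma v) <= K * Rabs (u - v).

Lemma lipschitz_with_sub K (gamma : R -> C) s t s' t' : s <= s' -> t' <= t ->
  lipschitz_with K gamma s t -> lipschitz_with K gamma s' t'.
Proof. intros Hs Ht H u v Hu Hv. apply H; lra. Qed.

Lemma lipschitz_with_continuous K (gamma : R -> C) s t :
  lipschitz_with K gamma s t -> continuous_on_itv gamma s t.
Proof.
  intros HK u Hu P HP. destruct (proj1 locally_Cmod HP) as [e [He H]].
  assert (HK1 := Rabs_pos K).
  assert (Hd : 0 < e / (Rabs K + 1)) by (apply Rdiv_lt_0_compat; lra).
  exists (mkposreal _ Hd). intros v Hvu Hv. apply H.
  change (Rabs (v - u) < e / (Rabs K + 1)) in Hvu.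
  apply (Rmult_lt_compat_l (Rabs K + 1)) in Hvu; [|lra].
  replace ((Rabs K + 1) * (e / (Rabs K + 1))) with e in Hvu by (field; lra).
  eapply Rle_lt_trans; [now apply HK|]. assert (h := Rabs_pos (v - u)).
  assert (K * Rabs (v - u) <= Rabs K * Rabs (v - u))
    by (apply Rmult_le_compat_r; [exact h | apply Rle_abs]).
  lra.
Qed.

Lemma lipschitz_on_pos (gamma : R -> C) T : lipschitz_on gamma T ->
  exists K, 0 < K /\ lipschitz_with K gamma 0 T.
Proof.
  intros [K HK]. exists (Rmax K 1). split; [eapply Rlt_le_trans; [|apply Rmax_r]; lra|].
  intros u v Hu Hv. eapply Rle_trans; [now apply HK|].
  apply Rmult_le_compat_r; [apply Rabs_pos | apply Rmax_l].
Qed.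

Lemma lipschitz_on_sub (gamma : R -> C) T t : t <= T ->
  lipschitz_on gamma T -> lipschitz_on gamma t.
Proof. intros Ht [K HK]. exists K. intros u v Hu Hv. apply HK; lra. Qed.

Lemma partition_of_bounds t p n i : partition_of t p n -> (i <= n)%nat -> 0 <= p i <= t.
Proof.
  intros [H0 [Hn Hm]] Hi.
  assert (Hmono : forall j k, (j + k <= n)%nat -> p j <= p (j + k)%nat).
  { intros j k. induction k as [|k IH]; intros Hk; [rewrite Nat.add_0_r; lra|].
    rewrite Nat.add_succ_r. specialize (IH ltac:(lia)).
    specialize (Hm (j + k)%nat ltac:(lia)). lra. }
  rewrite <- H0, <- Hn. split; [apply (Hmono 0%nat i); lia|].
  replace n with (i + (n - i))%nat by lia. apply Hmono. lia.
Qed.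

Lemma var_sum_le (gamma : R -> C) K t p n : lipschitz_with K gamma 0 t ->
  partition_of t p n -> var_sum gamma p n <= K * t.
Proof.
  intros HK Hp. assert (Hbounds := fun i => partition_of_bounds t p n i Hp).
  destruct Hp as [H0 [Hn Hm]].
  assert (Hpartial : forall k, (k <= n)%nat -> var_sum gamma p k <= K * p k).
  { induction k as [|k IH]; intros Hk; simpl; [rewrite H0; lra|].
    assert (Hstep := HK (p (S k)) (p k) (Hbounds (S k) Hk) (Hbounds k ltac:(lia))).
    specialize (Hm k Hk). rewrite Rabs_pos_eq in Hstep by lra.
    specialize (IH ltac:(lia)). lra. }
  rewrite <- Hn. now apply Hpartial.
Qed.

Lemma partition_of_trivial t : 0 <= t -> partition_of t (fun i => if i then 0 else t) 1.
Proof.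
  intros Ht. split; [|split]; auto. intros i Hi. now replace i with 0%nat by lia.
Qed.

Lemma path_length_is_lub (gamma : R -> C) t : 0 <= t -> lipschitz_on gamma t ->
  is_lub (fun l => exists p n, partition_of t p n /\ l = var_sum gamma p n) (path_length gamma t).
Proof.
  intros Ht [K HK].
  destruct (completeness (fun l => exists p n, partition_of t p n /\ l = var_sum gamma p n))
    as [m Hm].
  - exists (K * t). intros l [p [n [Hp ->]]]. now apply var_sum_le.
  - eexists. do 2 eexists. split; [now apply partition_of_trivial | reflexivity].
  - unfold path_length. rewrite (is_lub_Rbar_unique _ m); [exact Hm|].
    split; [intros l; apply Hm|]. intros [b| |] Hb; [now apply Hm | exact I |].
    apply (Hb _ (ex_intro _ _ (ex_intro _ 1%nat (conj (partition_of_trivial t Ht) eq_refl)))).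
Qed.

Lemma var_sum_le_path_length (gamma : R -> C) t p n : 0 <= t -> lipschitz_on gamma t ->
  partition_of t p n -> var_sum gamma p n <= path_length gamma t.
Proof. intros Ht HL Hp. apply (path_length_is_lub gamma t Ht HL). now exists p, n. Qed.

Lemma path_length_le (gamma : R -> C) K t : 0 <= t -> lipschitz_with K gamma 0 t ->
  path_length gamma t <= K * t.
Proof.
  intros Ht HK. apply (path_length_is_lub gamma t Ht (ex_intro _ K HK)).
  intros l [p [n [Hp ->]]]. now apply var_sum_le.
Qed.

Lemma path_length_ge_0 (gamma : R -> C) t : 0 <= t -> lipschitz_on gamma t ->
  0 <= path_length gamma t.
Proof.
  intros Ht HL.
  apply Rle_trans with (2 := var_sum_le_path_length _ _ _ _ Ht HL (partition_of_trivial t Ht)).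
  simpl. rewrite Rplus_0_l. apply Cmod_ge_0.
Qed.

Lemma path_length_0 (gamma : R -> C) : path_length gamma 0 = 0.
Proof.
  assert (HL : lipschitz_with 0 gamma 0 0).
  { intros u v Hu Hv. replace u with v by lra. rewrite Cmod_minus_diag. lra. }
  apply Rle_antisym.
  - rewrite <- (Rmult_0_l 0) at 2. apply path_length_le; [lra | exact HL].
  - apply path_length_ge_0; [lra | now exists 0].
Qed.

Lemma path_length_add (gamma : R -> C) s t : lipschitz_on gamma t -> 0 <= s <= t ->
  path_length gamma s + Cmod (gamma t - gamma s) <= path_length gamma t.
Proof.
  intros HL Hs.
  enough (path_length gamma s <= path_length gamma t - Cmod (gamma t - gamma s)) by lra.
  apply (path_length_is_lub gamma s); [lra | apply (lipschitz_on_sub gamma t); [lra | exact HL]|].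
  intros l [p [n [[H0 [Hn Hm]] ->]]].
  set (q := fun i => if Nat.leb i n then p i else t).
  assert (Eq : forall i, (i <= n)%nat -> q i = p i).
  { intros i Hi. unfold q. apply Nat.leb_le in Hi. now rewrite Hi. }
  assert (Et : q (S n) = t).
  { unfold q. now rewrite (proj2 (Nat.leb_gt (S n) n) (Nat.lt_succ_diag_r n)). }
  assert (Ev : forall k, (k <= n)%nat -> var_sum gamma q k = var_sum gamma p k).
  { induction k as [|k IH]; intros Hk; simpl; auto. now rewrite IH, !Eq by lia. }
  assert (Hq : partition_of t q (S n)).
  { split; [exact H0 | split; [exact Et|]].
    intros i Hi. destruct (Nat.eq_dec i n) as [->|Hne].
    - rewrite Et, Eq by lia. lra.
    - rewrite !Eq by lia. apply Hm. lia. }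
  assert (G := var_sum_le_path_length gamma t q (S n) ltac:(lra) HL Hq).
  cbn [var_sum] in G. rewrite Et, Ev, (Eq n), Hn in G by lia. lra.
Qed.

Lemma path_length_mono (gamma : R -> C) s t : lipschitz_on gamma t -> 0 <= s <= t ->
  path_length gamma s <= path_length gamma t.
Proof.
  intros HL Hs. assert (h := path_length_add gamma s t HL Hs).
  assert (h' := Cmod_ge_0 (gamma t - gamma s)). lra.
Qed.

Lemma Cmod_le_path_length (gamma : R -> C) T : in_Pi gamma T ->
  Cmod (gamma T) <= path_length gamma T.
Proof.
  intros [HT [HL H0]]. assert (h := path_length_add gamma 0 T HL ltac:(lra)).
  rewrite path_length_0, H0 in h. replace (gamma T - 0)%C with (gamma T) in h by ring. lra.
Qed.

Lemma in_Pi_sub (gamma : R -> C) T t : in_Pi gamma T -> 0 <= t <= T -> in_Pi gamma t.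
Proof.
  intros [_ [HL H0]] Ht. split; [lra | split; [|exact H0]].
  apply (lipschitz_on_sub gamma T); [lra | exact HL].
Qed.

Lemma in_Pi_continuous (gamma : R -> C) T : in_Pi gamma T -> continuous_on_itv gamma 0 T.
Proof. intros [_ [[K HK] _]]. exact (lipschitz_with_continuous K gamma 0 T HK). Qed.

(** * Detours around a finite set *)

Definition generic (Q : C -> Prop) : Prop :=
  forall (c : C) e, 0 < e -> exists c' : C, Cmod (c' - c) < e /\ locally c' Q.

Lemma generic_imp (P Q : C -> Prop) : (forall z, P z -> Q z) -> generic P -> generic Q.
Proof.
  intros HPQ HP c e He. destruct (HP c e He) as [c' [Hc' H]]. exists c'. split; auto.
  revert H. now apply filter_imp.
Qed.

Lemma generic_and (P Q : C -> Prop) : generic P -> generic Q -> generic (fun z => P z /\ Q z).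
Proof.
  intros HP HQ c e He. destruct (HP c e He) as [c1 [Hc1 HPc1]].
  destruct (proj1 locally_Cmod
    (filter_and _ _ (locally_Cdisc Hc1) (locally_locally _ _ HPc1))) as [d [Hd Hnear]].
  destruct (HQ c1 d Hd) as [c2 [Hc2 HQc2]]. destruct (Hnear c2 Hc2) as [Hc HPc2].
  exists c2. split; [exact Hc | now apply filter_and].
Qed.

Lemma generic_True : generic (fun _ => True).
Proof.
  intros c e He. exists c. rewrite Cmod_minus_diag. split; [exact He | now apply filter_forall].
Qed.

Lemma generic_Im_mult_neq_0 (p v : C) : v <> 0 -> generic (fun z => Im ((z - p) * v) <> 0).
Proof.
  intros Hv c e He.
  assert (Hm : 0 < Cmod v) by now apply Cmod_gt_0.
  assert (Hopen : forall z, Im ((z - p) * v) <> 0 -> locally z (fun w => Im ((w - p) * v) <> 0)).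
  { intros z Hz.
    assert (Hc : continuous (fun w => (w - p) * v)%C z).
    { apply ex_C_derive_continuous. eexists. apply (is_C_derive_mult _ (fun _ => v)).
      - apply is_C_derive_minus_const.
      - apply is_C_derive_const. }
    assert (Hc' := continuous_comp _ snd z Hc). destruct ((z - p) * v)%C as [x y] eqn:E.
    apply (Hc' (continuous_snd x y) (fun t => t <> 0)). rewrite E. exact (open_neq 0 y Hz). }
  destruct (Req_dec (Im ((c - p) * v)) 0) as [E|Hc].
  - set (t := e / (2 * Cmod v)). assert (Ht : 0 < t) by (apply Rdiv_lt_0_compat; lra).
    exists (c + t * (Ci * Cconj v))%C. split.
    + replace (c + t * (Ci * Cconj v) - c)%C with (t * (Ci * Cconj v))%C by ring.
      rewrite !Cmod_mult, Cmod_Ci, Cmod_conj, Cmod_R, Rabs_pos_eq by lra.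
      replace (t * (1 * Cmod v)) with (e / 2) by (unfold t; field; lra). lra.
    + apply Hopen.
      replace (Im ((c + t * (Ci * Cconj v) - p) * v)) with (Im ((c - p) * v) + t * Cmod v ^ 2)
        by (rewrite Cmod2_alt; destruct c, p, v; simpl; ring).
      rewrite E, Rplus_0_l. apply Rgt_not_eq, Rmult_lt_0_compat; [exact Ht | now apply pow_lt].
  - exists c. rewrite Cmod_minus_diag. auto.
Qed.

Lemma generic_neq (p : C) : generic (fun z => z <> p).
Proof.
  apply (generic_imp (fun z => Im ((z - p) * 1) <> 0)).
  - intros z Hz ->. apply Hz. replace ((p - p) * 1)%C with (RtoC 0) by ring. reflexivity.
  - apply generic_Im_mult_neq_0, C1_nz.
Qed.

Lemma generic_chord_avoids (p : C) (F : list C) :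
  generic (fun z => z <> p /\ forall x, x <> 0 -> ~ In (chord p z x) F).
Proof.
  induction F as [|w F IH].
  - apply (generic_imp (fun z => z <> p)); [simpl; auto | apply generic_neq].
  - destruct (Ceq_dec w p) as [->|Hwp].
    + revert IH. apply generic_imp. intros z [Hz HF]. split; auto.
      intros x Hx [E|Hin]; [|now apply (HF x)].
      assert (Hx' : RtoC x <> 0) by (intros H; now apply Hx, RtoC_inj).
      apply (Cmult_neq_0 x (z - p) Hx'); [now apply Cminus_eq_contra|].
      apply (f_equal (fun y => y - p)%C) in E. unfold chord in E. rewrite <- (Cplus_opp_r p).
      rewrite E at 1. ring.
    + (* Otherwise z would lie on the line through p and w, where (z - p) * conj (w - p) is real. *)
      assert (Hv : Cconj (w - p) <> 0).
      { apply Cmod_gt_0. rewrite Cmod_conj. now apply Cmod_gt_0, Cminus_eq_contra. }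
      apply (generic_imp (fun z => (z <> p /\ forall x, x <> 0 -> ~ In (chord p z x) F) /\
        Im ((z - p) * Cconj (w - p)) <> 0)).
      2:{ apply generic_and; [exact IH | now apply generic_Im_mult_neq_0]. }
      intros z [[Hz HF] Hline]. split; auto.
      intros x Hx [E|Hin]; [|now apply (HF x)].
      apply Hline, (Rmult_eq_reg_l x); auto. rewrite <- im_scal_l, Cmult_assoc.
      replace (RtoC x * (z - p))%C with (w - p)%C by (rewrite E; unfold chord; ring).
      rewrite <- Cmod2_conj, im_RtoC. ring.
Qed.

Definition avoids (F : list C) (gamma : R -> C) (s t : R) : Prop :=
  forall u, s < u <= t -> ~ In (gamma u) F.

(* F is avoided at positive times only, as it may contain the origin. *)
Definition avoiding_path (F : list C) (l : R) (sigma : R -> C) : Prop :=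
  0 <= l /\ lipschitz_with 1 sigma 0 l /\ sigma 0 = RtoC 0 /\ avoids F sigma 0 l.

Lemma lipschitz_with_glue K (sigma tau : R -> C) s l t : s <= l <= t -> sigma l = tau l ->
  lipschitz_with K sigma s l -> lipschitz_with K tau l t -> lipschitz_with K (glue l sigma tau) s t.
Proof.
  intros Hl E Hsigma Htau.
  assert (Hle : forall u v, s <= u <= t -> s <= v <= t -> u <= v ->
    Cmod (glue l sigma tau u - glue l sigma tau v) <= K * Rabs (u - v)).
  { intros u v Hu Hv Huv. destruct (Rle_dec v l) as [Hvl|Hvl].
    - rewrite !glue_left by lra. apply Hsigma; lra.
    - rewrite (glue_right _ _ _ v) by (auto; lra). destruct (Rle_dec u l) as [Hul|Hul].
      + rewrite glue_left by lra.
        eapply Rle_trans; [apply (Cmod_minus_triangle (sigma l))|].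
        assert (Hul_le := Hsigma u l ltac:(lra) ltac:(lra)).
        assert (Hlv_le := Htau l v ltac:(lra) ltac:(lra)). rewrite <- E in Hlv_le.
        rewrite (Rabs_left1 (u - l)) in Hul_le by lra.
        rewrite (Rabs_left1 (l - v)) in Hlv_le by lra.
        rewrite (Rabs_left1 (u - v)) by lra. lra.
      + rewrite glue_right by (auto; lra). apply Htau; lra. }
  intros u v Hu Hv. destruct (Rle_dec u v) as [Huv|Huv]; [now apply Hle|].
  rewrite Cmod_minus_sym, Rabs_minus_sym. apply Hle; auto; lra.
Qed.

Lemma avoiding_path_glue (F : list C) l l' (sigma tau : R -> C) : l <= l' ->
  avoiding_path F l sigma -> sigma l = tau l -> lipschitz_with 1 tau l l' -> avoids F tau l l' ->
  avoiding_path F l' (glue l sigma tau).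
Proof.
  intros Hl' [Hl [Hsigma [H0 Hav]]] E Htau Hav'.
  split; [lra|]. split; [now apply lipschitz_with_glue|]. split; [now rewrite glue_left|].
  intros u Hu. destruct (Rle_dec u l) as [Hul|Hul].
  - rewrite glue_left by lra. apply Hav. lra.
  - rewrite glue_right by (auto; lra). apply Hav'. lra.
Qed.

Definition reaches (a : nat -> C) (F : list C) (p : C) (h : C -> C) (l : R) : Prop :=
  exists sigma f, avoiding_path F l sigma /\ germ_family sigma 0 l f /\ is_germ_of a (f 0) /\
    sigma l = p /\ germ_eq p (f l) h.

Section Detours.

Variables (a : nat -> C) (F : list C).

Lemma reaches_origin (h : C -> C) : holomorphic_at h 0 -> is_germ_of a h -> reaches a F 0 h 0.
Proof.
  intros Hh Hg.
  assert (HL : lipschitz_with 1 (fun _ => RtoC 0) 0 0).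
  { intros u v _ _. rewrite Cmod_minus_diag, Rmult_1_l. apply Rabs_pos. }
  exists (fun _ => RtoC 0), (fun _ => h). split.
  - split; [lra|]. split; [exact HL|]. split; [reflexivity|]. intros u Hu. lra.
  - split; [|split; [exact Hg | split; reflexivity]].
    apply germ_family_const; auto. exact (lipschitz_with_continuous 1 _ 0 0 HL).
Qed.

Lemma reaches_germ_eq (p : C) (h h' : C -> C) l :
  reaches a F p h l -> germ_eq p h h' -> reaches a F p h' l.
Proof.
  intros [sigma [f [Hsigma [Hf [Hg [Hp Hfh]]]]]] Hh. exists sigma, f.
  repeat (split; [assumption|]).
  now transitivity h.
Qed.

Lemma reaches_chord (p p' : C) (h : C -> C) l : reaches a F p h l -> p' <> p ->
  (forall t, 0 <= t <= 1 -> holomorphic_at h (chord p p' t)) -> avoids F (chord p p') 0 1 ->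
  reaches a F p' h (l + Cmod (p' - p)).
Proof.
  intros [sigma [f [Hsigma [Hf [Hg [Hp Hh]]]]]] Hne Hhol Hav.
  assert (Hl := proj1 Hsigma).
  set (m := Cmod (p' - p)).
  assert (Hm : 0 < m) by now apply Cmod_gt_0, Cminus_eq_contra.
  assert (Hparam : forall u, l <= u <= l + m -> 0 <= (u - l) / m <= 1).
  { intros u Hu. split; [apply Rdiv_le_0_compat; lra|].
    apply (Rmult_le_reg_r m); auto. replace ((u - l) / m * m) with (u - l) by (field; lra). lra. }
  set (tau := fun t => chord p p' ((t - l) / m)).
  assert (Htau : lipschitz_with 1 tau l (l + m)).
  { intros u v _ _. unfold tau. rewrite Cmod_chord_minus. fold m.
    replace ((u - l) / m - (v - l) / m) with ((u - v) / m) by (field; lra).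
    unfold Rdiv. rewrite Rabs_mult, (Rabs_pos_eq (/ m)) by (left; now apply Rinv_0_lt_compat).
    right. field. lra. }
  assert (E : sigma l = tau l).
  { unfold tau. rewrite Hp. replace ((l - l) / m) with 0 by (field; lra). now rewrite chord_0. }
  assert (Htau_avoids : avoids F tau l (l + m)).
  { intros u Hu. apply Hav. split; [apply Rdiv_lt_0_compat; lra | apply Hparam; lra]. }
  assert (Hglue := avoiding_path_glue F l (l + m) sigma tau ltac:(lra) Hsigma E Htau Htau_avoids).
  exists (glue l sigma tau), (glue l f (fun _ => h)). split; [exact Hglue|]. split.
  - apply germ_family_glue; [lra | | | |].
    + apply (lipschitz_with_continuous 1), Hglue.
    + apply (germ_family_ext sigma); auto. intros u Hu. now rewrite glue_left.
    + apply (germ_family_ext tau); [intros u Hu; now rewrite glue_right|].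
      apply germ_family_const; [now apply (lipschitz_with_continuous 1)|].
      intros u Hu. now apply Hhol, Hparam.
    + rewrite glue_left, Hp by lra. exact Hh.
  - split; [now rewrite glue_left|]. split.
    + rewrite glue_right by (auto; lra). unfold tau.
      replace ((l + m - l) / m) with 1 by (field; lra). apply chord_1.
    + unfold glue. destruct (Rle_dec (l + m) l); [lra | reflexivity].
Qed.

Lemma reaches_generic_near (p g c : C) (h : C -> C) l r (Q : C -> Prop) e :
  reaches a F p h l -> holo_on_disc h c r -> Cmod (p - c) < r -> Cmod (g - c) < r ->
  generic Q -> 0 < e ->
  exists p', Cmod (p' - g) < e /\ Q p' /\ reaches a F p' h (l + Cmod (p' - p)).
Proof.
  intros HR Hh Hp Hg HQ He.
  destruct (proj1 locally_Cmod (locally_Cdisc Hg)) as [d [Hd Hdisc]].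
  destruct (generic_and _ _ HQ (generic_chord_avoids p F) g (Rmin e d)) as [p' [Hp' H]];
    [now apply Rmin_glb_lt|].
  apply locally_singleton in H. destruct H as [HQp' [Hne Hav]].
  exists p'. split; [eapply Rlt_le_trans; [exact Hp' | apply Rmin_l]|]. split; [exact HQp'|].
  apply reaches_chord; auto.
  - intros t Ht. apply (holo_on_disc_holomorphic_at h c _ r Hh), chord_in_disc; auto.
    apply Hdisc. eapply Rlt_le_trans; [exact Hp' | apply Rmin_r].
  - intros u Hu. apply Hav. lra.
Qed.

Definition approachable (gamma : R -> C) (f : R -> C -> C) (t : R) : Prop :=
  forall (Q : C -> Prop) e, generic Q -> 0 < e -> exists p l,
    Cmod (p - gamma t) < e /\ Q p /\ reaches a F p (f t) l /\ l <= path_length gamma t + e.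

Lemma approachable_extend (gamma : R -> C) (f : R -> C -> C) (h : C -> C) (c : C) r v u :
  lipschitz_on gamma u -> 0 <= v <= u ->
  holo_on_disc h c r -> Cmod (gamma v - c) < r -> Cmod (gamma u - c) < r ->
  germ_eq (gamma v) (f v) h -> germ_eq (gamma u) (f u) h ->
  approachable gamma f v -> approachable gamma f u.
Proof.
  intros HL Hvu Hh Hv Hu Hfv Hfu Happr Q e HQ He.
  destruct (proj1 locally_Cmod
    (filter_and _ _ (locally_Cdisc Hv) (locally_locally _ _ Hfv))) as [d [Hd Hnear_v]].
  destruct (proj1 locally_Cmod (locally_locally _ _ Hfu)) as [d' [Hd' Hnear_u]].
  destruct (Happr _ (Rmin (e / 3) d) generic_True) as [p [l [Hp [_ [HR Hl]]]]];
    [apply Rmin_glb_lt; lra|].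
  assert (Hmin_l := Rmin_l (e / 3) d). assert (Hmin_r := Rmin_r (e / 3) d).
  destruct (Hnear_v p ltac:(lra)) as [Hpc Hpf].
  apply (reaches_germ_eq _ _ h) in HR; [|exact Hpf].
  destruct (reaches_generic_near p (gamma u) c h l r Q (Rmin (e / 3) d') HR Hh Hpc Hu HQ)
    as [p' [Hp' [HQp' HR']]]; [apply Rmin_glb_lt; lra|].
  assert (Hmin_l' := Rmin_l (e / 3) d'). assert (Hmin_r' := Rmin_r (e / 3) d').
  exists p', (l + Cmod (p' - p)). split; [lra|]. split; [exact HQp'|]. split.
  - apply (reaches_germ_eq _ h); [exact HR'|]. symmetry. apply Hnear_u. lra.
  - assert (T1 := Cmod_minus_triangle (gamma u) p' p).
    assert (T2 := Cmod_minus_triangle (gamma v) (gamma u) p).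
    rewrite (Cmod_minus_sym (gamma v) p) in T2.
    assert (G := path_length_add gamma v u HL Hvu). lra.
Qed.

Lemma germ_family_approachable (gamma : R -> C) T f : in_Pi gamma T ->
  germ_family gamma 0 T f -> is_germ_of a (f 0) -> approachable gamma f T.
Proof.
  intros HPi Hf Hg. assert (HT := proj1 HPi). destruct HPi as [_ [HL H0]].
  assert (Hc : continuous_on_itv gamma 0 T) by (apply in_Pi_continuous; split; auto).
  apply (interval_induction (approachable gamma f) 0 T HT).
  - intros Q e HQ He. destruct (Hf 0 ltac:(lra)) as [Hh _]. rewrite H0 in *.
    destruct (proj1 holomorphic_at_iff Hh) as [r [Hr Hdisc]].
    assert (Hcenter : Cmod (0 - 0) < r) by now rewrite Cmod_minus_diag.
    destruct (reaches_generic_near 0 0 0 (f 0) 0 r Q e (reaches_origin (f 0) Hh Hg)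
      Hdisc Hcenter Hcenter HQ He) as [p [Hp [HQp HR]]].
    exists p, (0 + Cmod (p - 0)). rewrite path_length_0. repeat split; auto. lra.
  - intros u Hu. destruct (Hf u Hu) as [Hh Hcomp].
    destruct (proj1 holomorphic_at_iff Hh) as [r [Hr Hdisc]].
    assert (Hcenter : Cmod (gamma u - gamma u) < r) by now rewrite Cmod_minus_diag.
    generalize (filter_and _ _ Hcomp
      (continuous_on_itv_locally Hc Hu (locally_Cmod_lt (gamma u) r Hr))).
    apply filter_imp. intros v [Hvg Hvr] Hv. specialize (Hvg Hv). specialize (Hvr Hv).
    split; intros Hle; (apply (approachable_extend gamma f (f u) (gamma u) r);
      auto; try lra; try reflexivity); apply (lipschitz_on_sub gamma T); auto; lra.
Qed.

Lemma germ_family_reaches (gamma : R -> C) T f e : in_Pi gamma T ->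
  germ_family gamma 0 T f -> is_germ_of a (f 0) -> ~ In (gamma T) F -> 0 < e ->
  exists l, reaches a F (gamma T) (f T) l /\ l <= path_length gamma T + e.
Proof.
  intros HPi Hf Hg HT He.
  assert (HT0 := proj1 HPi). destruct (Hf T ltac:(lra)) as [Hh _].
  destruct (proj1 holomorphic_at_iff Hh) as [r [Hr Hdisc]].
  destruct (germ_family_approachable gamma T f HPi Hf Hg _ (Rmin (e / 2) r)
    (generic_chord_avoids (gamma T) F)) as [p [l [Hp [[Hne Hav] [HR Hl]]]]];
    [apply Rmin_glb_lt; lra|].
  assert (Hmin_l := Rmin_l (e / 2) r). assert (Hmin_r := Rmin_r (e / 2) r).
  exists (l + Cmod (gamma T - p)). split; [|rewrite Cmod_minus_sym; lra].
  apply reaches_chord; auto.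
  - intros t Ht. apply (holo_on_disc_holomorphic_at _ (gamma T) _ r Hdisc), chord_in_disc; auto.
    + lra.
    + now rewrite Cmod_minus_diag.
  - intros u Hu. destruct (Req_dec u 1) as [->|Hu1]; [now rewrite chord_1|].
    replace (chord p (gamma T) u) with (chord (gamma T) p (1 - u))
      by (unfold chord; rewrite RtoC_minus; ring).
    apply Hav. lra.
Qed.

End Detours.

(** * Singular points of the continuations of a germ *)

Lemma finite_set_sub (A : C -> Prop) (F : list C) : (forall w, A w -> In w F) -> finite_set A.
Proof.
  intros HA. exists (filter (fun w => if excluded_middle_informative (A w) then true else false) F).
  intros w. rewrite filter_In. destruct (excluded_middle_informative (A w)) as [Hw|Hw].
  - split; auto.
  - split; [tauto|]. now intros [_ H].
Qed.

Lemma locally_not_In (w : C) (F : list C) : ~ In w F -> locally w (fun z => ~ In z F).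
Proof.
  induction F as [|x F IH]; intros Hw; [now apply filter_forall|]. simpl in Hw.
  apply (filter_imp (fun z => z <> x /\ ~ In z F)).
  - intros z [Hz Hin] [E|H]; [now apply Hz | tauto].
  - apply filter_and; [apply locally_neq; intros E; now apply Hw; left | apply IH; tauto].
Qed.

(* The constant path is not available, as the origin may belong to F. *)
Lemma endlessly_continuable_germ (a : nat -> C) : endlessly_continuable a ->
  exists f, holomorphic_at f 0 /\ is_germ_of a f.
Proof.
  intros Ha. destruct (Ha 1 Rlt_0_1) as [F HF].
  destruct (generic_chord_avoids 0 F 0 (/ 2)) as [p [Hp H]]; [lra|].
  apply locally_singleton in H. destruct H as [_ Hav].
  assert (HL : lipschitz_with (Cmod (p - 0)) (chord 0 p) 0 1)
    by (intros u v _ _; rewrite Cmod_chord_minus; lra).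
  assert (Hc := lipschitz_with_continuous _ _ _ _ HL).
  assert (Hcont : continuable_along a (chord 0 p) 1).
  { apply HF.
    - split; [lra|]. split; [now exists (Cmod (p - 0)) | apply chord_0].
    - eapply Rle_lt_trans; [apply (path_length_le _ _ 1 Rle_0_1 HL) | lra].
    - intros t Ht. apply Hav. lra. }
  destruct (proj1 (continuable_alongE a _ 1 Hc) Hcont) as [f [Hf Hg]].
  exists (f 0). split; [|exact Hg]. rewrite <- (chord_0 0 p). apply (Hf 0). lra.
Qed.

Lemma endlessly_continuable_short (a : nat -> C) : endlessly_continuable a ->
  exists r, 0 < r /\ forall gamma T, in_Pi gamma T -> path_length gamma T < r ->
    continuable_along a gamma T.
Proof.
  intros Ha. destruct (endlessly_continuable_germ a Ha) as [f [Hf Hg]].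
  destruct (proj1 holomorphic_at_iff Hf) as [r [Hr Hdisc]].
  exists r. split; [exact Hr|]. intros gamma T HPi Hlen.
  assert (Hc := in_Pi_continuous gamma T HPi).
  apply continuable_alongE; [exact Hc|]. exists (fun _ => f). split; [|exact Hg].
  apply germ_family_const; [exact Hc|]. intros u Hu.
  apply (holo_on_disc_holomorphic_at f 0 _ r Hdisc).
  replace (gamma u - 0)%C with (gamma u) by ring.
  eapply Rle_lt_trans; [apply Cmod_le_path_length, (in_Pi_sub gamma T); auto|].
  eapply Rle_lt_trans; [|exact Hlen]. apply path_length_mono; [apply HPi | exact Hu].
Qed.

Lemma continuable_along_sub (a : nat -> C) (gamma : R -> C) T t : in_Pi gamma T -> 0 <= t <= T ->
  continuable_along a gamma T -> continuable_along a gamma t.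
Proof.
  intros HPi Ht. assert (Hc := in_Pi_continuous gamma T HPi).
  assert (Hct := continuous_on_itv_sub gamma 0 T 0 t ltac:(lra) ltac:(lra) Hc).
  rewrite !continuable_alongE by assumption. intros [f [Hf Hg]]. exists f. split; [|exact Hg].
  apply (germ_family_sub gamma 0 T); auto; lra.
Qed.

Lemma locally_continuable_along (a : nat -> C) (gamma : R -> C) T t :
  in_Pi gamma T -> 0 <= t <= T -> continuable_along a gamma t ->
  locally t (fun u => t <= u <= T -> continuable_along a gamma u).
Proof.
  intros HPi Ht Hcont. assert (Hc := in_Pi_continuous gamma T HPi).
  assert (Hsub := fun s u Hs Hu => continuous_on_itv_sub gamma 0 T s u Hs Hu Hc).
  destruct (proj1 (continuable_alongE a gamma t (Hsub 0 t ltac:(lra) ltac:(lra))) Hcont)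
    as [f [Hf Hg]].
  destruct (Hf t ltac:(lra)) as [Hhol _].
  destruct (proj1 locally_R
    (continuous_on_itv_locally Hc Ht (locally_locally _ _ Hhol))) as [d [Hd Hnear]].
  apply locally_R. exists d. split; [exact Hd|]. intros u Hut Hu.
  apply continuable_alongE; [apply Hsub; lra|]. exists (glue t f (fun _ => f t)). split.
  - apply germ_family_glue; auto; [lra | apply Hsub; lra | | reflexivity].
    apply germ_family_const; [apply Hsub; lra|].
    intros v Hv. apply Hnear; lra.
  - rewrite glue_left by lra. exact Hg.
Qed.

Definition singular_points (a : nat -> C) (lam : R) (w : C) : Prop :=
  exists gamma T, in_Pi gamma T /\ path_length gamma T <= lam /\ gamma T = w /\
    (forall t, 0 <= t < T -> continuable_along a gamma t) /\ ~ continuable_along a gamma T.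

Lemma singular_points_closure (a : nat -> C) (gamma : R -> C) T : in_Pi gamma T ->
  (forall t, 0 <= t < T -> continuable_along a gamma t) -> ~ continuable_along a gamma T ->
  in_closure_S (singular_points a) (path_length gamma T) (gamma T).
Proof.
  intros HPi Hpre Hnot e He. exists (path_length gamma T), (gamma T).
  rewrite Rminus_diag, Rabs_R0, Cmod_minus_diag. repeat split; auto.
  - apply path_length_ge_0; apply HPi.
  - exists gamma, T. repeat (split; auto; try lra).
Qed.

Lemma singular_points_Omega_continuable (a : nat -> C) : endlessly_continuable a ->
  Omega_continuable (singular_points a) a.
Proof.
  intros Ha gamma T [HPi HM].
  destruct (endlessly_continuable_short a Ha) as [r [Hr Hshort]].
  apply (interval_induction (continuable_along a gamma) 0 T (proj1 HPi)).
  { apply Hshort.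
    - apply (in_Pi_sub gamma T); [exact HPi | split; [lra | apply HPi]].
    - now rewrite path_length_0. }
  intros u Hu. destruct (classic (continuable_along a gamma u)) as [Hc|Hc].
  - generalize (locally_continuable_along a gamma T u HPi Hu Hc). apply filter_imp.
    intros v H Hv. split; [auto|]. intros Huv _. apply H. lra.
  - assert (Hstuck : exists v0, 0 <= v0 < u /\ ~ continuable_along a gamma v0).
    { apply NNPP. intros Hno. apply (HM u Hu), singular_points_closure; auto.
      - now apply (in_Pi_sub gamma T).
      - intros t Ht. apply NNPP. eauto. }
    destruct Hstuck as [v0 [Hv0 Hn]]. generalize (open_gt v0 u (proj2 Hv0)). apply filter_imp.
    intros v Hv0v Hv. split; [|tauto]. intros Hvu Hcv. exfalso. apply Hn.
    apply (continuable_along_sub a gamma v); auto; [now apply (in_Pi_sub gamma T) | lra].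
Qed.

Definition continuable_off (a : nat -> C) (F : list C) (L : R) : Prop :=
  forall gamma, in_Pi gamma 1 -> path_length gamma 1 < L ->
    (forall t, 0 < t <= 1 -> ~ In (gamma t) F) -> continuable_along a gamma 1.

Lemma avoiding_path_germ_family (a : nat -> C) (F : list C) L l (sigma : R -> C) :
  continuable_off a F L -> avoiding_path F l sigma -> 0 < l < L ->
  exists f, germ_family sigma 0 l f /\ is_germ_of a (f 0).
Proof.
  intros HF [_ [HL [H0 Hav]]] Hl.
  set (gamma := fun x => sigma (l * x)).
  assert (HLg : lipschitz_with l gamma 0 1).
  { intros u v Hu Hv. eapply Rle_trans; [apply HL; nra|].
    rewrite <- Rmult_minus_distr_l, Rabs_mult, (Rabs_pos_eq l) by lra. lra. }
  assert (Hcont : continuable_along a gamma 1).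
  { apply HF.
    - split; [lra|]. split; [now exists l|]. unfold gamma. now rewrite Rmult_0_r.
    - eapply Rle_lt_trans; [apply (path_length_le gamma l 1 Rle_0_1 HLg) | lra].
    - intros t Ht. apply Hav. nra. }
  destruct (proj1 (continuable_alongE a gamma 1 (lipschitz_with_continuous _ _ _ _ HLg)) Hcont)
    as [f [Hf Hg]].
  exists (fun x => f (0 + / l * x)). split.
  - apply (germ_family_ext (fun x => gamma (0 + / l * x))).
    + intros u _. unfold gamma. f_equal. field. lra.
    + apply germ_family_reparam; [left; apply Rinv_0_lt_compat; lra|].
      replace (0 + / l * 0) with 0 by ring. now replace (0 + / l * l) with 1 by (field; lra).
  - now replace (0 + / l * 0) with 0 by ring.
Qed.

Lemma reaches_germ_family (a : nat -> C) (F : list C) L (h : C -> C) l (gamma : R -> C) K s t :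
  continuable_off a F L -> reaches a F (gamma s) h l ->
  0 < K -> s < t -> lipschitz_with K gamma s t -> (forall u, s <= u <= t -> ~ In (gamma u) F) ->
  l + K * (t - s) < L ->
  exists g, germ_family gamma s t g /\ germ_eq (gamma s) h (g s).
Proof.
  intros HF [sigma [f [Hsigma [Hf [Hf0 [Hp Hh]]]]]] HK Hst HL Hav HlL.
  assert (Hl := proj1 Hsigma). set (m := K * (t - s)) in *.
  assert (Hm : 0 < m) by (apply Rmult_lt_0_compat; lra).
  set (tau := fun u => gamma (s + (u - l) / K)).
  assert (Hparam : forall u, l <= u <= l + m -> s <= s + (u - l) / K <= t).
  { intros u Hu. assert (0 <= (u - l) / K) by (apply Rdiv_le_0_compat; lra).
    assert ((u - l) / K <= t - s); [|lra]. apply (Rmult_le_reg_l K); auto.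
    replace (K * ((u - l) / K)) with (u - l) by (field; lra). unfold m in Hu. lra. }
  assert (Htau : lipschitz_with 1 tau l (l + m)).
  { intros u v Hu Hv. unfold tau. eapply Rle_trans; [apply HL; now apply Hparam|].
    replace (s + (u - l) / K - (s + (v - l) / K)) with (/ K * (u - v)) by (field; lra).
    rewrite Rabs_mult, (Rabs_pos_eq (/ K)) by (left; now apply Rinv_0_lt_compat).
    right. field. lra. }
  assert (E : sigma l = tau l) by (unfold tau; rewrite Hp; f_equal; field; lra).
  assert (Hglue : avoiding_path F (l + m) (glue l sigma tau)).
  { apply avoiding_path_glue; auto; [lra|]. intros u Hu. apply Hav, Hparam. lra. }
  destruct (avoiding_path_germ_family a F L (l + m) _ HF Hglue ltac:(lra)) as [g [Hg Hg0]].
  exists (fun x => g ((l - K * s) + K * x)). split.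
  - apply (germ_family_ext (fun x => glue l sigma tau ((l - K * s) + K * x))).
    + intros u Hu. rewrite glue_right by (auto; nra). unfold tau. f_equal. field. lra.
    + apply germ_family_reparam; [lra|].
      replace (l - K * s + K * s) with l by ring.
      replace (l - K * s + K * t) with (l + m) by (unfold m; ring).
      apply (germ_family_sub _ 0 (l + m)); auto; lra.
  - replace (l - K * s + K * s) with l by ring. transitivity (f l); [now symmetry|].
    rewrite <- Hp. apply (germ_family_unique sigma 0 l); auto.
    + apply (lipschitz_with_continuous 1), Hsigma.
    + apply (germ_family_ext (glue l sigma tau)); [intros u Hu; apply glue_left; lra|].
      apply (germ_family_sub _ 0 (l + m)); auto; lra.
    + rewrite (proj1 (proj2 (proj2 Hsigma))). now apply (is_germ_of_unique a).
Qed.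

Lemma singular_points_In (a : nat -> C) (F : list C) L lam (w : C) : endlessly_continuable a ->
  continuable_off a F L -> lam < L -> singular_points a lam w -> In w F.
Proof.
  intros Ha HF HlamL [gamma [T [HPi [Hlen [<- [Hpre Hnot]]]]]].
  apply NNPP. intros HwF. assert (HPi' := HPi). destruct HPi' as [HT [HLip _]].
  assert (Hc := in_Pi_continuous gamma T HPi).
  destruct (Req_dec T 0) as [->|HT0].
  { destruct (endlessly_continuable_short a Ha) as [r [Hr Hshort]].
    apply Hnot, Hshort; [exact HPi | now rewrite path_length_0]. }
  destruct (lipschitz_on_pos gamma T HLip) as [K [HK HLK]].
  destruct (proj1 locally_R (continuous_on_itv_locally Hc
    (conj HT (Rle_refl T)) (locally_not_In _ _ HwF))) as [d [Hd Hnear]].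
  set (e := Rmin (d / 2) ((L - lam) / (4 * K))).
  assert (He0 : 0 < e) by (apply Rmin_glb_lt; [lra | apply Rdiv_lt_0_compat; lra]).
  assert (Hed : e <= d / 2) by apply Rmin_l.
  assert (HeK : K * e <= (L - lam) / 4).
  { replace ((L - lam) / 4) with (K * ((L - lam) / (4 * K))) by (field; lra).
    apply Rmult_le_compat_l; [lra | apply Rmin_r]. }
  set (s := Rmax 0 (T - e)).
  assert (Hs : 0 <= s < T /\ T - e <= s).
  { split; [split; [apply Rmax_l | apply Rmax_lub_lt; lra] | apply Rmax_r]. }
  assert (Htail : forall u, s <= u <= T -> ~ In (gamma u) F).
  { intros u Hu. apply Hnear; lra. }
  assert (Hcs := continuous_on_itv_sub gamma 0 T 0 s ltac:(lra) ltac:(lra) Hc).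
  destruct (proj1 (continuable_alongE a gamma s Hcs) (Hpre s ltac:(lra))) as [f [Hf Hg]].
  assert (HPis : in_Pi gamma s) by (apply (in_Pi_sub gamma T); auto; lra).
  destruct (germ_family_reaches a F gamma s f ((L - lam) / 4) HPis Hf Hg) as [l [HR Hl]];
    [apply Htail; lra | lra |].
  assert (Hlens := path_length_mono gamma s T HLip ltac:(lra)).
  destruct (reaches_germ_family a F L (f s) l gamma K s T HF HR HK) as [g [Hgfam Hgs]];
    [lra | apply (lipschitz_with_sub K gamma 0 T); auto; lra | exact Htail | nra |].
  apply Hnot, continuable_alongE; [exact Hc|]. exists (glue s f g). split.
  - apply germ_family_glue; auto; lra.
  - rewrite glue_left by lra. exact Hg.
Qed.

Lemma singular_points_dfs (a : nat -> C) : endlessly_continuable a -> dfs (singular_points a).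
Proof.
  intros Ha. split; [|split].
  - intros L HL. destruct (Ha (L + 1)) as [F HF]; [lra|].
    apply (finite_set_sub _ F). intros w. apply (singular_points_In a F (L + 1) L); auto. lra.
  - intros L1 L2 w _ HL [gamma [T [HPi [Hlen H]]]]. exists gamma, T. repeat (split; auto). lra.
  - destruct (endlessly_continuable_short a Ha) as [r [Hr Hshort]].
    exists (r / 2). split; [lra|]. intros w [gamma [T [HPi [Hlen [_ [_ Hnot]]]]]].
    apply Hnot, Hshort; [exact HPi | lra].
Qed.

Lemma in_closure_S_dfs (Omega : R -> C -> Prop) lam L (w : C) : dfs Omega -> 0 <= L -> lam < L ->
  in_closure_S Omega lam w -> Omega L w.
Proof.
  intros [Hfin [Hmono _]] HL0 HL Hcl. destruct (Hfin L HL0) as [F HF].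
  apply HF, NNPP. intros Hw.
  destruct (proj1 locally_Cmod (locally_not_In w F Hw)) as [d [Hd Hnear]].
  destruct (Hcl (Rmin d (L - lam))) as [lam' [w' [[Hlam' HO] [Hdlam Hdw]]]];
    [apply Rmin_glb_lt; lra|].
  assert (Hmin_l := Rmin_l d (L - lam)). assert (Hmin_r := Rmin_r d (L - lam)).
  apply Rabs_def2 in Hdlam.
  apply (Hnear w'); [rewrite Cmod_minus_sym; lra|].
  apply HF, (Hmono lam'); auto. lra.
Qed.

Lemma Omega_continuable_endlessly_continuable (Omega : R -> C -> Prop) (a : nat -> C) : dfs Omega ->
  Omega_continuable Omega a -> endlessly_continuable a.
Proof.
  intros HO Hcont L HL.
  assert (HO' := HO). destruct HO' as [Hfin [_ [delta [Hdelta Hempty]]]].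
  destruct (Hfin L) as [F HF]; [lra|]. exists F. intros gamma HPi Hlen Hav.
  apply Hcont. split; [exact HPi|]. intros t Ht Hcl.
  destruct (Req_dec t 0) as [->|Ht0].
  - rewrite path_length_0 in Hcl. apply (Hempty (gamma 0)).
    apply (in_closure_S_dfs Omega 0); auto; lra.
  - apply (Hav t ltac:(lra)), HF, (in_closure_S_dfs Omega (path_length gamma t)); auto; [lra|].
    eapply Rle_lt_trans; [|exact Hlen]. apply path_length_mono; [apply HPi | exact Ht].
Qed.

Theorem theorem2p13 :
  (forall a : nat -> C,
     hatR a <-> exists Omega : R -> C -> Prop, dfs Omega /\ hatR_Omega Omega a) /\
  (forall phi : nat -> C,
     resurgent phi <-> exists Omega : R -> C -> Prop, dfs Omega /\ Omega_resurgent Omega phi).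
Proof.
  assert (H : forall a : nat -> C,
     hatR a <-> exists Omega : R -> C -> Prop, dfs Omega /\ hatR_Omega Omega a).
  { intros a. split.
    - intros [Hconv Ha]. exists (singular_points a). split; [now apply singular_points_dfs|].
      split; [exact Hconv | now apply singular_points_Omega_continuable].
    - intros [Omega [HO [Hconv Hc]]]. split; [exact Hconv|].
      now apply (Omega_continuable_endlessly_continuable Omega). }
  split; [exact H|]. intros phi. apply H.
Qed.
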